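(* Let $\alpha\in\{1/m,1\}$, and let either $m\in\{2,\dots,n-1\}$, or $m=n$, $X$ nonparallel and the metric asymptotic to the hyperbolic model. Let $h(r)\ge1$ be a positive function such that, as $r\to+\infty$, $$\frac{\Gamma(r)(1-\Gamma^2(r))}{1+\Gamma^2(r)(m\alpha-1)}\left[\log\left(\frac{\chi^{1/\alpha}(r)}{S_m(r)}\right)\right]'=o\left(\frac1{h(r)}\right)\quad\text{and}\quad\frac{h'(r)}{h(r)}\to0.$$ Let $y(r)=\cos\phi(r)$, where $\phi=\phi(r)$ is the angle function of an orbit of the soliton system in $\mathbb R_+\times Q_1$, $Q_1=(0,\pi/2]$ (defined for all large $r$). Then, as $r\to+\infty$, $$y(r)=\Gamma(r)+o\left(\frac1{h(r)}\right).$$ For a metric asymptotic to the Euclidean model ($\mathbb R^{n+1}$), the function $h(r)=r^{(m+\delta)\alpha}$, $\delta\in(0,1)$, satisfies the hypotheses above. For a metric asymptotic to the Riemannian product model ($\mathbb H^n\times\mathbb R$) or to the hyperbolic model ($\mathbb H^{n+1}$), the function $h(r)=e^{r^\delta}$, $\delta\in(0,1)$, satisfies the hypotheses above.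
   Context: Ambient space. $(\mathbb P,\sigma)$ is an $n$-dimensional Cartan–Hadamard manifold with a pole $o$ and global polar coordinates $(r,\theta)\in(0,\infty)\times\mathbb S^{n-1}$ in which $\sigma=dr^2+\xi^2(r)\,d\theta^2$, where $d\theta^2$ is the round metric and $\xi>0$ is smooth and extends smoothly as $r\to0^+$. $\chi=\chi(r)$ is a smooth positive radial function. $\bar M=\mathbb P\times_\chi\mathbb R$ is $\mathbb P\times\mathbb R$ with the metric $dr^2+\xi^2(r)d\theta^2+\chi^2(r)ds^2$. $X=\partial_s$ is a Killing field, parallel iff $\chi$ is constant. $c>0$ is a constant. Standing structural conditions. (SC1) $\chi$ is non-decreasing; either $\chi\equiv1$, or $\chi(r)\to\chi_\infty\in(1,\infty)$, or $\chi(r)\to+\infty$ as $r\to\infty$. (SC2) $\xi'/\xi$ is decreasing and $(\xi'\chi')/(\xi\chi)$ is non-increasing. (SC3) As $r\to0$, $\xi(r)=r+O(r^3)$, and either $\chi\equiv1$ or $\chi(r)=1+\frac{r^2}2+O(r^4)$. (SC4) As $r\to+\infty$ the metric is asymptotic to one of: (Euclidean model) $\xi(r)=r+O(r^{-1})$, $\chi(r)=\chi_\infty+O(r^{-1})$ with $\chi_\infty\in[1,\infty)$; (Riemannian product model) $\xi(r)=e^r+O(r^{-1})$, $\chi(r)=\chi_\infty+O(r^{-1})$ with $\chi_\infty\in[1,\infty)$; (hyperbolic model) $\xi(r)=e^r+O(r^{-1})$ and $\chi(r)=e^r+O(r^{-1})$. Definitions. $S_m(r)=\Big[\binom{n-1}{m-1}\frac{\chi'}{\chi}+\binom{n-1}{m}\frac{\xi'}{\xi}\Big]\Big(\frac{\xi'}{\xi}\Big)^{m-1}$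 with $\binom{n-1}{n}=0$ (the $m$-th mean curvature of the Killing cylinder of radius $r$). $f(x)=x^{1/\alpha}(1-x^2)^{-m/2}$ on $[0,1)$, an increasing bijection onto $[0,\infty)$. $\Gamma(r)\in[0,1)$ is defined by $f(\Gamma(r))=S_m(r)/(c\chi(r))^{1/\alpha}$. A rotationally symmetric hypersurface $(r(\tau),\theta,s(\tau))$, $\tau$ arc length of the profile curve, with $\dot r=\cos\phi$, $\chi\dot s=\sin\phi$, is a translating soliton ($S^\alpha=c\langle X,N\rangle$, $S$ the $m$-th elementary symmetric function of the principal curvatures) when $$\binom{n-1}{m-1}\Big(\frac{\xi'}{\xi}\Big)^{m-1}\sin^{m-1}\phi\;\dot\phi=(c\chi\cos\phi)^{1/\alpha}-S_m(r)\sin^m\phi;$$ its orbits are the curves $(r(\tau),\phi(\tau))$. For orbits in $\mathbb R_+\times Q_1$, $y=\cos\phi$ as a function of $r$ satisfies $$\frac{dy}{dr}=\binom{n-1}{m-1}^{-1}\Big(\frac{\xi}{\xi'}\Big)^{m-1}(c\chi)^{1/\alpha}\,\frac{1-y^2}{y}\,\big[f(\Gamma(r))-f(y)\big].$$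
   Formalization: In the Euclidean and product examples of h, the expansions of ξ, χ are read as twice differentiable termwise; the product example also assumes χ′, χ″ = o(e^{-r^δ}) (both are false otherwise). Throughout, e^r in the models is read up to a positive constant factor. *)

(* Defs.v *)
(* Stdlib reals and Coquelicot.

   The rotationally symmetric manifolds are represented by their profiles:
   [xi] is the warping function of sigma = dr^2 + xi(r)^2 dtheta^2 on P and [chi]
   that of P x_chi R.  Only the values of [xi] and [chi] on (0, +oo) matter. *)
From Stdlib Require Import Reals Lra Lia Psatz Arith.
From Coquelicot Require Import Coquelicot.
Open Scope R_scope.

(* [Binomial.C] is not 0 when k > n. *)
Definition binom (n k : nat) : R :=
  if (k <=? n)%nat then Binomial.C n k else 0.

(* x^p on [0, +oo) for p > 0; Stdlib's [Rpower 0 p] is 1. *)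
Definition rpow (x p : R) : R :=
  if Rle_dec x 0 then 0 else Rpower x p.

Definition big_O (F : (R -> Prop) -> Prop) (E g : R -> R) : Prop :=
  exists K : R, F (fun r => Rabs (E r) <= K * Rabs (g r)).

(* E = o(g) as r -> +oo; [is_domin] takes the dominating function first. *)
Definition little_o_inf (E g : R -> R) : Prop :=
  is_domin (Rbar_locally p_infty) g E.

Definition extends_smoothly (f : R -> R) : Prop :=
  exists g : R -> R,
    (forall (k : nat) (x : R), ex_derive_n g k x) /\
    (forall r : R, 0 < r -> g r = f r).

(* Sectional curvatures of sigma on planes containing d/dr and on planes tangent
   to the geodesic spheres; every sectional curvature is a convex combination of
   the two.  The second kind of plane exists only if n >= 3. *)
Definition radial_curvature (xi : R -> R) (r : R) : R :=
  - (Derive_n xi 2 r / xi r).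

Definition spherical_curvature (xi : R -> R) (r : R) : R :=
  (1 - Derive xi r ^ 2) / xi r ^ 2.

(* Completeness and simple connectedness are automatic, the polar coordinates
   being global on (0, +oo) x S^(n-1). *)
Definition cartan_hadamard (n : nat) (xi : R -> R) : Prop :=
  forall r : R, 0 < r ->
    radial_curvature xi r <= 0 /\
    ((3 <= n)%nat -> spherical_curvature xi r <= 0).

Definition dlog (f : R -> R) (r : R) : R := Derive f r / f r.

Definition SC1 (chi : R -> R) : Prop :=
  (forall r t : R, 0 < r -> r <= t -> chi r <= chi t) /\
  ((forall r : R, 0 < r -> chi r = 1) \/
   (exists chi_inf : R, 1 < chi_inf /\ is_lim chi p_infty (Finite chi_inf)) \/
   is_lim chi p_infty p_infty).

Definition SC2 (xi chi : R -> R) : Prop :=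
  (forall r t : R, 0 < r -> r < t -> dlog xi t < dlog xi r) /\
  (forall r t : R, 0 < r -> r <= t ->
     dlog xi t * dlog chi t <= dlog xi r * dlog chi r).

Definition SC3 (xi chi : R -> R) : Prop :=
  big_O (at_right 0) (fun r => xi r - r) (fun r => r ^ 3) /\
  ((forall r : R, 0 < r -> chi r = 1) \/
   big_O (at_right 0) (fun r => chi r - (1 + r ^ 2 / 2)) (fun r => r ^ 4)).

(* The remainder O(1/r), first for the function alone, then for an expansion that
   may be differentiated twice term by term. *)
Definition inv_remainder (E : R -> R) : Prop :=
  big_O (Rbar_locally p_infty) E (fun r => / r).

Definition inv_remainder2 (E : R -> R) : Prop :=
  inv_remainder E /\
  big_O (Rbar_locally p_infty) (Derive E) (fun r => / r ^ 2) /\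
  big_O (Rbar_locally p_infty) (Derive_n E 2) (fun r => / r ^ 3).

Definition Euclidean_model (remainder : (R -> R) -> Prop) (xi chi : R -> R) : Prop :=
  remainder (fun r => xi r - r) /\
  exists chi_inf : R, 1 <= chi_inf /\ remainder (fun r => chi r - chi_inf).

(* In the two models below e^r is taken up to a positive factor: H^n has
   xi = sinh r = e^r/2 + O(1/r) and H^(n+1) moreover chi = cosh r, whereas with
   factor 1 the hyperbolic model would contradict SC2 and SC3. *)
Definition product_model (remainder : (R -> R) -> Prop) (xi chi : R -> R) : Prop :=
  (exists a : R, 0 < a /\ remainder (fun r => xi r - a * exp r)) /\
  exists chi_inf : R, 1 <= chi_inf /\ remainder (fun r => chi r - chi_inf).

Definition hyperbolic_model (remainder : (R -> R) -> Prop) (xi chi : R -> R) : Prop :=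
  (exists a : R, 0 < a /\ remainder (fun r => xi r - a * exp r)) /\
  (exists b : R, 0 < b /\ remainder (fun r => chi r - b * exp r)).

Definition SC4 (xi chi : R -> R) : Prop :=
  Euclidean_model inv_remainder xi chi \/
  product_model inv_remainder xi chi \/
  hyperbolic_model inv_remainder xi chi.

Record ambient_space (n : nat) (xi chi : R -> R) : Prop := {
  ambient_dim : (2 <= n)%nat;
  ambient_xi_pos : forall r : R, 0 < r -> 0 < xi r;
  ambient_xi_smooth : extends_smoothly xi;
  ambient_chi_pos : forall r : R, 0 < r -> 0 < chi r;
  ambient_chi_smooth : extends_smoothly chi;
  ambient_cartan_hadamard : cartan_hadamard n xi;
  ambient_SC1 : SC1 chi;
  ambient_SC2 : SC2 xi chi;
  ambient_SC3 : SC3 xi chi;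
  ambient_SC4 : SC4 xi chi }.

(* The Killing field d/ds is parallel iff chi is constant. *)
Definition X_parallel (chi : R -> R) : Prop :=
  exists k : R, forall r : R, 0 < r -> chi r = k.

Definition S_cyl (n m : nat) (xi chi : R -> R) (r : R) : R :=
  (binom (n - 1) (m - 1) * dlog chi r + binom (n - 1) m * dlog xi r) *
  dlog xi r ^ (m - 1).

Definition f_sol (m : nat) (alpha x : R) : R :=
  rpow x (/ alpha) * Rpower (1 - x ^ 2) (- (INR m / 2)).

(* Determines [Gamma] on (0, +oo), [f_sol] being injective on [0, 1). *)
Definition is_Gamma (n m : nat) (alpha c : R) (xi chi Gamma : R -> R) : Prop :=
  forall r : R, 0 < r ->
    0 <= Gamma r < 1 /\
    f_sol m alpha (Gamma r) = S_cyl n m xi chi r / Rpower (c * chi r) (/ alpha).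

Definition is_interval (I : R -> Prop) : Prop :=
  forall a b t : R, I a -> I b -> a <= t <= b -> I t.

(* (rho, phi) solves the soliton system on the interval I, with values in
   R_+ x Q_1, Q_1 = (0, pi/2].  [locally tau I] says that tau is interior to I; at
   an endpoint belonging to I only one-sided continuity is required. *)
Definition orbit_in_Q1 (n m : nat) (alpha c : R) (xi chi : R -> R)
    (I : R -> Prop) (rho phi : R -> R) : Prop :=
  is_interval I /\
  (forall tau : R, I tau ->
     0 < rho tau /\ 0 < phi tau <= PI / 2 /\
     filterlim rho (within I (locally tau)) (locally (rho tau)) /\
     filterlim phi (within I (locally tau)) (locally (phi tau))) /\
  (forall tau : R, locally tau I ->
     is_derive rho tau (cos (phi tau)) /\
     ex_derive phi tau /\
     binom (n - 1) (m - 1) * dlog xi (rho tau) ^ (m - 1) *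
       sin (phi tau) ^ (m - 1) * Derive phi tau
     = rpow (c * chi (rho tau) * cos (phi tau)) (/ alpha)
       - S_cyl n m xi chi (rho tau) * sin (phi tau) ^ m).

(* [Phi] is, for all large r, the angle of the orbit as a function of r. *)
Definition is_angle_function (I : R -> Prop) (rho phi Phi : R -> R) : Prop :=
  Rbar_locally p_infty
    (fun r => exists tau : R, I tau /\ rho tau = r /\ Phi r = phi tau).

Definition admissible_rate (n m : nat) (alpha : R) (xi chi Gamma h : R -> R) : Prop :=
  Rbar_locally p_infty (fun r => 1 <= h r /\ ex_derive h r) /\
  little_o_inf
    (fun r =>
       Gamma r * (1 - Gamma r ^ 2) / (1 + Gamma r ^ 2 * (INR m * alpha - 1)) *
       Derive (fun t => ln (Rpower (chi t) (/ alpha) / S_cyl n m xi chi t)) r)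
    (fun r => / h r) /\
  is_lim (fun r => Derive h r / h r) p_infty 0.

(* Main.v *)
(* Write u = xi'/xi and k = 1/alpha.  Along an orbit, the difference w = y - Gamma
   satisfies dw/dr = - p w - Gamma', where p is bounded below by a positive constant
   for large r.  The first condition on h says Gamma' = o(1/h), because the
   logarithmic derivative of f(Gamma) = S_m / (c chi)^k is minus that of
   chi^k / S_m.  As h'/h -> 0, it follows that (h w)^2 is contracted at a fixed
   exponential rate up to an arbitrarily small error, so that h w -> 0.  The
   argument runs in the parameter tau, which avoids inverting r(tau).

   For the concrete rates, convexity of xi gives u >= 1/r and - u^2 <= u' <= 0.  In
   the hyperbolic model SC4 does not control the derivatives of xi and chi, but
   (xi' chi') / (xi chi) is non-increasing, tends to 1 at the axis by SC3 and cannot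
   stay below 1 at infinity, so it is identically 1: hence chi'/chi = 1/u, and chi''
   is controlled by u'. *)
Require Import Defs.
From Stdlib Require Import Reals Lra Lia Psatz Arith.
From Coquelicot Require Import Coquelicot.
Open Scope R_scope.

(** Two effects threaten the lower bound on p: 1 - y^2 vanishes as y -> 1, and for alpha = 1/m the
    function f is of order y^m as y -> 0. The first is offset by the blow-up of f, since m >= 2. For
    the second, f(x)/x is nondecreasing, so the rate is governed by its value at max(y, Gamma), and
    a bound S_m >= beta u^m keeps Gamma from being too small. Since d/dtau = y d/dr and y may
    vanish, the estimates along an orbit carry a factor y and never divide by it.

    For the concrete rates, Gamma and the logarithmic derivative of chi^k / S_m share the decay
    differently. Euclidean: O(r^(-m alpha)) times O(1/r). Hyperbolic: O(e^(-r)) times a bounded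
    factor. Product: Gamma does not tend to 0, so the logarithmic derivative alone must be
    o(e^(-r^delta)). A power of 1/r is too weak a bound on chi' and chi'' for that, which is why
    their decay is a hypothesis in this model. *)

(** * Elementary calculus, remainders at 0 and at infinity, exponential growth *)

Lemma mean_value (f df : R -> R) (a b : R) :
  a <= b -> (forall x, a <= x <= b -> is_derive f x (df x)) ->
  exists x, a <= x <= b /\ f b - f a = df x * (b - a).
Proof.
  intros Hab Hd.
  destruct (MVT_gen f a b df) as [x [Hx E]].
  - intros x Hx. rewrite Rmin_left, Rmax_right in Hx by lra. apply Hd; lra.
  - intros x Hx. rewrite Rmin_left, Rmax_right in Hx by lra.
    apply derivable_continuous_pt. exists (df x).
    apply is_derive_Reals, Hd; lra.
  - rewrite Rmin_left, Rmax_right in Hx by lra. now exists x.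
Qed.

Lemma nonincreasing_of_derive (f df : R -> R) (a b : R) :
  a <= b -> (forall x, a <= x <= b -> is_derive f x (df x)) ->
  (forall x, a <= x <= b -> df x <= 0) -> f b <= f a.
Proof.
  intros Hab Hd Hn.
  destruct (mean_value f df a b Hab Hd) as [x [Hx E]].
  specialize (Hn x Hx). nra.
Qed.

Lemma derive_nonpos (f : R -> R) (x l : R) :
  is_derive f x l -> (forall t, x < t -> f t <= f x) -> l <= 0.
Proof.
  intros Hd Hf. destruct (Rle_or_lt l 0) as [|Hl]; [easy|exfalso].
  apply is_derive_Reals in Hd. destruct (Hd l Hl) as [d Hd'].
  pose proof (cond_pos d) as Hp.
  assert (Hh : Rabs ((f (x + d / 2) - f x) / (d / 2) - l) < l).
  { apply Hd'; [lra|]. rewrite Rabs_right; lra. }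
  apply Rabs_def2 in Hh.
  assert (H2 : f (x + d / 2) <= f x) by (apply Hf; lra).
  assert (0 < (f (x + d / 2) - f x) / (d / 2)) by lra.
  assert (E : (f (x + d / 2) - f x) / (d / 2) * (d / 2) = f (x + d / 2) - f x) by (field; lra).
  nra.
Qed.

Lemma big_O_infty_bound (E g : R -> R) :
  big_O (Rbar_locally p_infty) E g ->
  exists K M : R, 0 < K /\ 1 <= M /\ forall r, M < r -> Rabs (E r) <= K * Rabs (g r).
Proof.
  intros [K [M H]]. exists (Rmax 1 K), (Rmax 1 M).
  split; [pose proof (Rmax_l 1 K); lra|]. split; [apply Rmax_l|].
  intros r Hr. apply Rmax_Rlt in Hr. eapply Rle_trans; [apply H; tauto|].
  apply Rmult_le_compat_r; [apply Rabs_pos|apply Rmax_r].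
Qed.

Lemma big_O_right_bound (E g : R -> R) :
  big_O (at_right 0) E g ->
  exists K d : R, 0 < K /\ 0 < d /\ forall r, 0 < r < d -> Rabs (E r) <= K * Rabs (g r).
Proof.
  intros [K [d H]]. exists (Rmax 1 K), d.
  split; [pose proof (Rmax_l 1 K); lra|]. split; [apply cond_pos|].
  intros r Hr. eapply Rle_trans; [apply H|].
  - unfold ball; simpl; unfold AbsRing_ball, abs, minus, plus, opp; simpl.
    rewrite Ropp_0, Rplus_0_r, Rabs_right; lra.
  - lra.
  - apply Rmult_le_compat_r; [apply Rabs_pos|apply Rmax_r].
Qed.

Lemma inv_remainder_bound (E : R -> R) :
  inv_remainder E ->
  exists K M : R, 0 < K /\ 1 <= M /\ forall r, M < r -> Rabs (E r) <= K / r.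
Proof.
  intros H. destruct (big_O_infty_bound _ _ H) as (K & M & HK & HM & HE).
  exists K, M. split; [easy|]. split; [easy|]. intros r Hr.
  specialize (HE r Hr). rewrite Rabs_inv, (Rabs_right r) in HE by lra. exact HE.
Qed.

(** Near a point r > 0 the function agrees with its globally smooth extension; its values on r <= 0
    are arbitrary. *)
Lemma smooth_derive (f : R -> R) (r : R) :
  extends_smoothly f -> 0 < r ->
  is_derive f r (Derive f r) /\ is_derive (Derive f) r (Derive_n f 2 r).
Proof.
  intros (g & Hg & Heq) Hr.
  assert (L : locally r (fun t => g t = f t)).
  { apply (filter_imp (fun t => 0 < t)); [exact Heq|]. apply (open_gt 0 r Hr). }
  split; apply Derive_correct.
  - apply (ex_derive_n_ext_loc g f 1 r L). apply (Hg 1%nat).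
  - apply (ex_derive_n_ext_loc g f 2 r L). apply (Hg 2%nat).
Qed.

(** The second logarithmic derivative (log f)'', expanded. *)
Definition ddlog (f : R -> R) (r : R) : R := Derive_n f 2 r / f r - dlog f r ^ 2.

Lemma is_derive_dlog (f : R -> R) (r : R) :
  extends_smoothly f -> 0 < r -> 0 < f r ->
  is_derive (dlog f) r (ddlog f r).
Proof.
  intros Hf Hr Hp. destruct (smooth_derive f r Hf Hr) as [H1 H2].
  unfold ddlog, dlog.
  evar_last.
  { apply is_derive_div; [exact H2|exact H1|lra]. }
  unfold minus, plus, opp, scal, mult; simpl; unfold mult; simpl.
  change (Derive_n f 2 r) with (Derive (Derive f) r). field. lra.
Qed.

Lemma is_derive_ln_comp (f : R -> R) (r l : R) :
  is_derive f r l -> 0 < f r -> is_derive (fun t => ln (f t)) r (l / f r).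
Proof.
  intros Hd Hp. evar_last.
  { apply (is_derive_comp ln f r (/ f r) l); [apply is_derive_Reals, derivable_pt_lim_ln; easy|exact Hd]. }
  reflexivity.
Qed.

Lemma eventually_le_exp (C : R) : exists M, 1 <= M /\ forall r, M < r -> C <= exp r.
Proof.
  exists (Rmax 1 C). split; [apply Rmax_l|]. intros r Hr. apply Rmax_Rlt in Hr.
  pose proof (exp_ineq1_le r). lra.
Qed.

Lemma exp_equiv (f : R -> R) (a : R) :
  0 < a -> inv_remainder (fun r => f r - a * exp r) ->
  exists M, 1 <= M /\ forall r, M < r -> a / 2 * exp r <= f r <= 2 * a * exp r.
Proof.
  intros Ha H. destruct (inv_remainder_bound _ H) as (K & M & HK & HM & HE).
  destruct (eventually_le_exp (2 * K / a)) as (M' & HM' & HC).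
  exists (Rmax M M'). split; [eapply Rle_trans; [exact HM|apply Rmax_l]|].
  intros r Hr. apply Rmax_Rlt in Hr. destruct Hr as [Hr Hr'].
  specialize (HE r Hr). specialize (HC r Hr').
  assert (K / r <= K).
  { apply (Rmult_le_reg_r r); [lra|]. unfold Rdiv. rewrite Rmult_assoc, Rinv_l by lra. nra. }
  assert (K <= a / 2 * exp r).
  { replace K with (a / 2 * (2 * K / a)) by (field; lra).
    apply Rmult_le_compat_l; lra. }
  apply Rabs_le_between in HE. split; nra.
Qed.

(** Integrating the bound on f'/f gives f <= const e^(l r), while f >= (a/2) e^r for large r. Only
    the size of [f] enters, so the undifferentiated remainder of [SC4] is enough. *)
Lemma exp_growth_dlog (f : R -> R) (a r0 l : R) :
  extends_smoothly f -> (forall r, 0 < r -> 0 < f r) ->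
  0 < a -> inv_remainder (fun r => f r - a * exp r) ->
  0 < r0 -> (forall r, r0 <= r -> dlog f r <= l) -> 1 <= l.
Proof.
  intros Hs Hp Ha Hrem Hr0 Hl.
  destruct (Rle_or_lt 1 l) as [|Hl1]; [easy|exfalso].
  destruct (exp_equiv f a Ha Hrem) as (M & HM & HE).
  (* The two bounds on ln f(r) combine to (1 - l) r <= [C]; the chosen [r] satisfies (1 - l) r >=
     [C] + 1. *)
  set (C := ln (f r0) - l * r0 - ln (a / 2)).
  set (r := Rmax (M + 1) (Rmax r0 ((C + 1) / (1 - l)))).
  assert (Hr : M < r /\ r0 <= r /\ (C + 1) / (1 - l) <= r).
  { unfold r. pose proof (Rmax_l (M + 1) (Rmax r0 ((C + 1) / (1 - l)))).
    pose proof (Rmax_r (M + 1) (Rmax r0 ((C + 1) / (1 - l)))).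
    pose proof (Rmax_l r0 ((C + 1) / (1 - l))).
    pose proof (Rmax_r r0 ((C + 1) / (1 - l))). lra. }
  destruct Hr as (Hr1 & Hr2 & Hr3).
  assert (Hmono : ln (f r) - l * r <= ln (f r0) - l * r0).
  { apply (nonincreasing_of_derive (fun t => ln (f t) - l * t) (fun t => dlog f t - l)); [easy| |].
    - intros t Ht. apply (is_derive_minus (fun t => ln (f t)) (fun t => l * t) t (dlog f t) l).
      + apply is_derive_ln_comp; [apply smooth_derive; [easy|lra]|apply Hp; lra].
      + auto_derive; [easy|ring].
    - intros t Ht. specialize (Hl t). lra. }
  destruct (HE r Hr1) as [HE1 _].
  assert (ln (a / 2) + r <= ln (f r)).
  { rewrite <- (ln_exp r) at 1. rewrite <- ln_mult by (try apply exp_pos; lra).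
    apply ln_le; [|easy]. apply Rmult_lt_0_compat; [lra|apply exp_pos]. }
  assert (C + 1 <= r * (1 - l)).
  { apply (Rmult_le_compat_r (1 - l)) in Hr3; [|lra].
    replace ((C + 1) / (1 - l) * (1 - l)) with (C + 1) in Hr3 by (field; lra). easy. }
  unfold C in *. nra.
Qed.

(** * Consequences of curvature, SC2 and SC3 for the two warping functions *)

(** Nonpositive radial curvature is xi'' >= 0. *)
Lemma Derive_xi_incr (n : nat) (xi chi : R -> R) (s r : R) :
  ambient_space n xi chi -> 0 < s <= r -> Derive xi s <= Derive xi r.
Proof.
  intros H Hsr.
  assert (E : - Derive xi r <= - Derive xi s); [|lra].
  apply (nonincreasing_of_derive (fun t => - Derive xi t) (fun t => - Derive_n xi 2 t)); [lra| |].
  - intros t Ht. apply (is_derive_opp (Derive xi)).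
    apply (smooth_derive xi t); [apply H|lra].
  - intros t Ht. destruct (ambient_cartan_hadamard _ _ _ H t) as [Hc _]; [lra|].
    assert (Hp : 0 < xi t) by (apply H; lra).
    unfold radial_curvature in Hc.
    assert (E : Derive_n xi 2 t = Derive_n xi 2 t / xi t * xi t) by (field; lra).
    nra.
Qed.

Lemma xi_near_0 (n : nat) (xi chi : R -> R) :
  ambient_space n xi chi ->
  exists K d : R, 0 < K /\ 0 < d /\ forall r, 0 < r < d -> Rabs (xi r - r) <= K * r ^ 3.
Proof.
  intros H. destruct (ambient_SC3 _ _ _ H) as [H3 _].
  destruct (big_O_right_bound _ _ H3) as (K & d & HK & Hd & HE).
  exists K, d. split; [easy|]. split; [easy|]. intros r Hr.
  specialize (HE r Hr). rewrite (Rabs_right (r ^ 3)) in HE; [easy|].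
  apply Rle_ge, pow_le; lra.
Qed.

(* The slope of the convex function xi at r is at least that of the chord
   from the origin. *)
Lemma dlog_xi_ge (n : nat) (xi chi : R -> R) (r : R) :
  ambient_space n xi chi -> 0 < r -> / r <= dlog xi r.
Proof.
  intros H Hr.
  assert (Hp : 0 < xi r) by (apply H; lra).
  assert (E : xi r <= r * Derive xi r).
  { destruct (Rle_or_lt (xi r) (r * Derive xi r)) as [|Hlt]; [easy|exfalso].
    destruct (xi_near_0 _ _ _ H) as (K & d & HK & Hd & HE).
    (* By convexity and [SC3], xi(r) <= xi(s) + xi'(r) (r - s) <= s + K s^3 + xi'(r) (r - s), so [e]
       <= s [D] for every small s <= 1. The choice s <= [e] / (2 [D]) contradicts this. *)
    set (e := xi r - r * Derive xi r) in *.
    set (D := 1 + Rabs (Derive xi r) + K).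
    assert (HD : 1 <= D) by (unfold D; pose proof (Rabs_pos (Derive xi r)); lra).
    set (s := Rmin (Rmin 1 (d / 2)) (Rmin r (e / (2 * D)))).
    assert (He : 0 < e / (2 * D)) by (apply Rdiv_lt_0_compat; unfold e; lra).
    assert (Hs : 0 < s) by (unfold s; repeat apply Rmin_glb_lt; lra).
    assert (Hs1 : s <= 1) by (unfold s; eapply Rle_trans; [apply Rmin_l|apply Rmin_l]).
    assert (Hs2 : s <= d / 2) by (unfold s; eapply Rle_trans; [apply Rmin_l|apply Rmin_r]).
    assert (Hs3 : s <= r) by (unfold s; eapply Rle_trans; [apply Rmin_r|apply Rmin_l]).
    assert (Hs4 : s <= e / (2 * D)) by (unfold s; eapply Rle_trans; [apply Rmin_r|apply Rmin_r]).
    destruct (mean_value xi (Derive xi) s r Hs3) as [x [Hx Ex]].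
    { intros t Ht. apply smooth_derive; [apply H|lra]. }
    assert (Hm : Derive xi x <= Derive xi r) by (apply (Derive_xi_incr n xi chi); [easy|lra]).
    specialize (HE s). assert (HE' : Rabs (xi s - s) <= K * s ^ 3) by (apply HE; lra).
    apply Rabs_le_between in HE'.
    assert (Hs5 : s ^ 3 <= s) by (simpl; nra).
    assert (Hs6 : K * s ^ 3 <= K * s) by nra.
    assert (Hs7 : - Derive xi r <= Rabs (Derive xi r)).
    { rewrite <- Rabs_Ropp. apply Rle_abs. }
    assert (Hs8 : s * (2 * D) <= e).
    { apply (Rmult_le_compat_r (2 * D)) in Hs4; [|lra].
      replace (e / (2 * D) * (2 * D)) with e in Hs4 by (field; lra). easy. }
    assert (Derive xi x * (r - s) <= Derive xi r * (r - s)) by (apply Rmult_le_compat_r; lra).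
    assert (- Derive xi r * s <= Rabs (Derive xi r) * s) by (apply Rmult_le_compat_r; lra).
    unfold D, e in *. nra. }
  unfold dlog. apply (Rmult_le_reg_r (xi r * r)); [nra|].
  replace (/ r * (xi r * r)) with (xi r) by (field; lra).
  replace (Derive xi r / xi r * (xi r * r)) with (r * Derive xi r) by (field; lra). easy.
Qed.

Lemma dlog_xi_pos (n : nat) (xi chi : R -> R) (r : R) :
  ambient_space n xi chi -> 0 < r -> 0 < dlog xi r.
Proof.
  intros H Hr. pose proof (dlog_xi_ge _ _ _ _ H Hr).
  pose proof (Rinv_0_lt_compat r Hr). lra.
Qed.

Lemma dlog_xi_le (n : nat) (xi chi : R -> R) (s r : R) :
  ambient_space n xi chi -> 0 < s <= r -> dlog xi r <= dlog xi s.
Proof.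
  intros H Hsr. destruct (Req_dec s r) as [->|]; [lra|].
  apply Rlt_le, (ambient_SC2 _ _ _ H); lra.
Qed.

(** The lower bound is xi''/xi >= 0, that is, the curvature condition; the upper bound is the
    monotonicity in [SC2]. *)
Lemma ddlog_xi_bounds (n : nat) (xi chi : R -> R) (r : R) :
  ambient_space n xi chi -> 0 < r ->
  - dlog xi r ^ 2 <= ddlog xi r <= 0.
Proof.
  intros H Hr. split.
  - destruct (ambient_cartan_hadamard _ _ _ H r Hr) as [Hc _].
    unfold radial_curvature in Hc. unfold ddlog. lra.
  - apply (derive_nonpos (dlog xi) r).
    + apply is_derive_dlog; [apply H|easy|apply H; easy].
    + intros t Ht. apply (dlog_xi_le n xi chi); [easy|lra].
Qed.

Lemma dlog_chi_nonneg (n : nat) (xi chi : R -> R) (r : R) :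
  ambient_space n xi chi -> 0 < r -> 0 <= dlog chi r.
Proof.
  intros H Hr.
  assert (Hp : 0 < chi r) by (apply H; lra).
  assert (- Derive chi r <= 0).
  { apply (derive_nonpos (fun t => - chi t) r).
    - apply (is_derive_opp chi). apply smooth_derive; [apply H|easy].
    - intros t Ht. apply Ropp_le_contravar. apply (ambient_SC1 _ _ _ H); lra. }
  unfold dlog. apply Rmult_le_pos; [lra|]. apply Rlt_le, Rinv_0_lt_compat; easy.
Qed.

(** [SC3] bounds xi but not xi'. Convexity turns values into a slope: xi'(r) is at most the slope of
    the chord over [r, 2r]. *)
Lemma dlog_xi_near_0 (n : nat) (xi chi : R -> R) :
  ambient_space n xi chi ->
  exists K d : R, 0 < K /\ 0 < d /\ forall r, 0 < r < d -> r * dlog xi r <= 1 + K * r ^ 2.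
Proof.
  intros H. destruct (xi_near_0 _ _ _ H) as (K & d & HK & Hd & HE).
  (* With t = K r^2, the chord gives xi' <= 1 + 9 t (8 t from the error at 2r, t from that at r),
     and xi >= r (1 - t). Then 1 + 9 t <= (1 + 20 t)(1 - t) as soon as t <= 1/2; [d / 2] keeps 2r
     inside the domain of [HE]. *)
  exists (20 * K), (Rmin (d / 2) (Rmin 1 (/ (2 * K)))).
  split; [lra|]. split.
  { assert (0 < / (2 * K)) by (apply Rinv_0_lt_compat; lra).
    repeat apply Rmin_glb_lt; lra. }
  intros r [Hr Hr'].
  apply Rmin_Rgt in Hr'. destruct Hr' as [Hr1 Hr'].
  apply Rmin_Rgt in Hr'. destruct Hr' as [Hr2 Hr3].
  assert (HKr : K * r ^ 2 <= / 2).
  { assert (K * r <= / 2).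
    { apply Rlt_le in Hr3. apply (Rmult_le_compat_l K) in Hr3; [|lra].
      replace (K * / (2 * K)) with (/ 2) in Hr3 by (field; lra). easy. }
    simpl. nra. }
  destruct (mean_value xi (Derive xi) r (2 * r)) as [x [Hx Ex]]; [lra| |].
  { intros t Ht. apply smooth_derive; [apply H|lra]. }
  assert (Hm : Derive xi r <= Derive xi x) by (apply (Derive_xi_incr n xi chi); [easy|lra]).
  assert (H1 : Rabs (xi r - r) <= K * r ^ 3) by (apply HE; lra).
  assert (H2 : Rabs (xi (2 * r) - 2 * r) <= K * (2 * r) ^ 3) by (apply HE; lra).
  apply Rabs_le_between in H1. apply Rabs_le_between in H2.
  assert (H3 : Derive xi r <= 1 + 9 * (K * r ^ 2)).
  { apply (Rmult_le_reg_r r); [lra|].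
    replace ((1 + 9 * (K * r ^ 2)) * r) with (r + 8 * (K * r ^ 3) + K * r ^ 3) by ring.
    apply Rle_trans with (Derive xi x * r); [apply Rmult_le_compat_r; lra|].
    replace ((2 * r) ^ 3) with (8 * r ^ 3) in H2 by ring. lra. }
  assert (H4 : r * (1 - K * r ^ 2) <= xi r).
  { replace (r * (1 - K * r ^ 2)) with (r - K * r ^ 3) by ring. lra. }
  assert (Hp : 0 < xi r) by (apply H; easy).
  unfold dlog. apply (Rmult_le_reg_r (xi r)); [lra|].
  replace (r * (Derive xi r / xi r) * xi r) with (r * Derive xi r) by (field; lra).
  set (t := K * r ^ 2) in *.
  assert (0 < t) by (apply Rmult_lt_0_compat; [lra|apply pow_lt; lra]).
  apply Rle_trans with (r * (1 + 9 * t)); [apply Rmult_le_compat_l; lra|].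
  replace (20 * K * r ^ 2) with (20 * t) by (unfold t; ring).
  apply Rle_trans with ((1 + 20 * t) * (r * (1 - t))); [|apply Rmult_le_compat_l; lra].
  replace ((1 + 20 * t) * (r * (1 - t))) with (r * ((1 + 20 * t) * (1 - t))) by ring.
  apply Rmult_le_compat_l; nra.
Qed.

Lemma dlog_const (f : R -> R) (k r : R) :
  (forall t, 0 < t -> f t = k) -> 0 < r -> dlog f r = 0.
Proof.
  intros Hf Hr. unfold dlog.
  rewrite (Derive_ext_loc f (fun _ => k)).
  - rewrite Derive_const. unfold Rdiv. ring.
  - apply (filter_imp (fun t => 0 < t)); [exact Hf|]. apply (open_gt 0 r Hr).
Qed.

(* Near the axis chi'/chi <= (1 + o(1)) r, while xi'/xi <= (1 + o(1)) / r. *)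
Lemma dlog_product_le_1 (n : nat) (xi chi : R -> R) (r : R) :
  ambient_space n xi chi -> 0 < r -> dlog xi r * dlog chi r <= 1.
Proof.
  intros H Hr1. destruct (ambient_SC3 _ _ _ H) as [_ [Hc|Hc]].
  { rewrite (dlog_const chi 1 r Hc Hr1). lra. }
  destruct (big_O_right_bound _ _ Hc) as (C & d' & HC & Hd' & HE').
  destruct (dlog_xi_near_0 _ _ _ H) as (K & d & HK & Hd & HE).
  destruct (Rle_or_lt (dlog xi r * dlog chi r) 1) as [|HQ]; [easy|exfalso].
  set (Q := dlog xi r * dlog chi r) in *.
  (* Here [Q] = 1 + 4 [e] and [Q'] = 1 + 2 [e]. By [SC2] the product is at least [Q] on (0, r],
     whence chi'/chi >= [Q'] t near the axis. [SC3] says nothing about chi', so the contradiction is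
     obtained after integration. *)
  set (Q' := (1 + Q) / 2).
  set (e := (Q - 1) / 4).
  set (r2 := Rmin (Rmin r (d / 2)) (Rmin (d' / 2) (Rmin 1 (Rmin (e / (K * Q')) (Rmin (e / (2 * C)) (/ (2 * C))))))).
  assert (He : 0 < e) by (unfold e; lra).
  assert (HQ' : 1 < Q') by (unfold Q'; lra).
  assert (0 < e / (K * Q')) by (apply Rdiv_lt_0_compat; nra).
  assert (0 < e / (2 * C)) by (apply Rdiv_lt_0_compat; nra).
  assert (0 < / (2 * C)) by (apply Rinv_0_lt_compat; lra).
  assert (Hr2 : 0 < r2) by (unfold r2; repeat apply Rmin_glb_lt; lra).
  assert (Hb : r2 <= r /\ r2 <= d / 2 /\ r2 <= d' / 2 /\ r2 <= 1 /\ r2 <= e / (K * Q') /\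
    r2 <= e / (2 * C) /\ r2 <= / (2 * C)).
  { assert (L := Rle_refl r2). unfold r2 at 2 in L. clearbody r2.
    repeat match goal with
    | L : _ <= Rmin ?a ?b |- _ =>
        let L1 := fresh "L" in let L2 := fresh "L" in
        assert (L1 := Rle_trans _ _ _ L (Rmin_l a b));
        assert (L2 := Rle_trans _ _ _ L (Rmin_r a b)); clear L
    end. repeat split; lra. }
  destruct Hb as (Hb1 & Hb2 & Hb3 & Hb4 & Hb5 & Hb6 & Hb7).
  assert (HK2 : K * Q' * r2 <= e).
  { apply (Rmult_le_compat_l (K * Q')) in Hb5; [|nra].
    replace (K * Q' * (e / (K * Q'))) with e in Hb5 by (field; split; lra). easy. }
  assert (HC2 : 2 * C * r2 <= e).
  { apply (Rmult_le_compat_l (2 * C)) in Hb6; [|nra].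
    replace (2 * C * (e / (2 * C))) with e in Hb6 by (field; lra). easy. }
  assert (Hv : forall t, 0 < t <= r2 -> Q' * t <= dlog chi t).
  { intros t Ht.
    assert (Hq : Q <= dlog xi t * dlog chi t).
    { apply (ambient_SC2 _ _ _ H); lra. }
    assert (Hu : t * dlog xi t <= 1 + K * t ^ 2) by (apply HE; lra).
    assert (Hup : 0 < dlog xi t) by (apply (dlog_xi_pos n xi chi); [easy|lra]).
    apply (Rmult_le_reg_l (dlog xi t)); [easy|].
    apply Rle_trans with Q; [|easy].
    assert (K * Q' * t ^ 2 <= e).
    { apply Rle_trans with (K * Q' * r2); [|easy].
      apply Rmult_le_compat_l; [nra|]. simpl. nra. }
    replace (dlog xi t * (Q' * t)) with (Q' * (t * dlog xi t)) by ring.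
    apply Rle_trans with (Q' * (1 + K * t ^ 2)); [apply Rmult_le_compat_l; lra|].
    unfold Q', e in *. nra. }
  assert (Hchi : forall t, 0 < t <= r2 -> 1 <= chi t).
  { intros t Ht.
    assert (E : Rabs (chi t - (1 + t ^ 2 / 2)) <= C * Rabs (t ^ 4)) by (apply HE'; lra).
    rewrite (Rabs_right (t ^ 4)) in E by (apply Rle_ge, pow_le; lra).
    apply Rabs_le_between in E.
    assert (C * t <= / 2).
    { apply Rle_trans with (C * r2); [nra|].
      apply (Rmult_le_compat_l C) in Hb7; [|lra].
      replace (C * / (2 * C)) with (/ 2) in Hb7 by (field; lra). easy. }
    replace (C * t ^ 4) with (C * t * (t * t ^ 2)) in E by ring.
    assert (0 <= t ^ 2) by (apply pow_le; lra).
    assert (t * t ^ 2 <= t ^ 2) by nra.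
    assert (0 <= t * t ^ 2) by nra. nra. }
  (* The function ln chi - [Q'] t^2 / 2 is nondecreasing on [s, r2]. At s it is at least -[Q'] s^2 /
     2; at [r2], since ln chi <= chi - 1 <= r2^2/2 + [e] r2^2/2, it is at most -[e] r2^2 / 2. This
     fails as s -> 0. *)
  assert (Hfin : forall s, 0 < s <= r2 -> - (Q' * s ^ 2 / 2) <= - (e * r2 ^ 2 / 2)).
  { intros s Hs.
    assert (M : - (ln (chi r2) - Q' * r2 ^ 2 / 2) <= - (ln (chi s) - Q' * s ^ 2 / 2)).
    { apply (nonincreasing_of_derive (fun t => - (ln (chi t) - Q' * t ^ 2 / 2))
               (fun t => - (dlog chi t - Q' * t))); [lra| |].
      - intros t Ht. apply (is_derive_opp (fun t => ln (chi t) - Q' * t ^ 2 / 2)).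
        apply (is_derive_minus (fun t => ln (chi t)) (fun t => Q' * t ^ 2 / 2)).
        + apply is_derive_ln_comp; [apply smooth_derive; [apply H|lra]|apply H; lra].
        + auto_derive; [easy|field].
      - intros t Ht. specialize (Hv t). lra. }
    assert (L1 : 0 <= ln (chi s)).
    { rewrite <- ln_1. apply ln_le; [lra|]. apply Hchi; lra. }
    assert (L2 : ln (chi r2) <= chi r2 - 1).
    { pose proof (exp_ineq1_le (ln (chi r2))) as X. rewrite exp_ln in X; [lra|].
      apply H; lra. }
    assert (E : Rabs (chi r2 - (1 + r2 ^ 2 / 2)) <= C * Rabs (r2 ^ 4)) by (apply HE'; lra).
    rewrite (Rabs_right (r2 ^ 4)) in E by (apply Rle_ge, pow_le; lra).
    apply Rabs_le_between in E.
    assert (0 <= r2 ^ 2) by (apply pow_le; lra).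
    assert (C * r2 ^ 4 <= e * r2 ^ 2 / 2).
    { replace (C * r2 ^ 4) with (C * r2 * (r2 * r2 ^ 2)) by ring.
      assert (r2 * r2 ^ 2 <= r2 ^ 2) by nra.
      assert (0 <= r2 * r2 ^ 2) by nra. nra. }
    assert (Q' = 1 + 2 * e) by (unfold Q', e; lra).
    nra. }
  set (s := Rmin r2 (e * r2 ^ 2 / (2 * Q'))).
  assert (Hp2 : 0 < r2 ^ 2) by (apply pow_lt; lra).
  assert (Hq0 : 0 < e * r2 ^ 2 / (2 * Q')) by (apply Rdiv_lt_0_compat; nra).
  assert (Hs : 0 < s) by (unfold s; apply Rmin_glb_lt; lra).
  assert (Hs1 : s <= r2) by apply Rmin_l.
  assert (Hs2 : s <= e * r2 ^ 2 / (2 * Q')) by apply Rmin_r.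
  assert (Hs3 : 2 * Q' * s <= e * r2 ^ 2).
  { apply (Rmult_le_compat_l (2 * Q')) in Hs2; [|lra].
    replace (2 * Q' * (e * r2 ^ 2 / (2 * Q'))) with (e * r2 ^ 2) in Hs2 by (field; lra). easy. }
  specialize (Hfin s (conj Hs Hs1)).
  assert (s ^ 2 <= s) by (simpl; nra). nra.
Qed.

Lemma dlog_xi_ge_1 (n : nat) (xi chi : R -> R) (a r : R) :
  ambient_space n xi chi -> 0 < a -> inv_remainder (fun t => xi t - a * exp t) ->
  0 < r -> 1 <= dlog xi r.
Proof.
  intros H Ha Hx Hr.
  apply (exp_growth_dlog xi a r); try apply H; try easy.
  intros t Ht. apply (dlog_xi_le n xi chi); [easy|lra].
Qed.

(* In the hyperbolic model the monotone product (xi' chi') / (xi chi) is squeezed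
   between its limits 1 at the axis and 1 at infinity. *)
Lemma hyperbolic_rigidity (n : nat) (xi chi : R -> R) (r : R) :
  ambient_space n xi chi -> hyperbolic_model inv_remainder xi chi ->
  0 < r -> dlog xi r * dlog chi r = 1.
Proof.
  intros H [(a & Ha & Hx) (b & Hb & Hc)] Hr.
  apply Rle_antisym; [apply (dlog_product_le_1 n); easy|].
  (* Used with l the product at [r]: since xi'/xi >= 1, at each t >= r the quantity chi'/chi is at
     most the product at t, hence at most l. *)
  apply (exp_growth_dlog chi b r); try apply H; try easy.
  intros t Ht.
  assert (Hu : 1 <= dlog xi t) by (apply (dlog_xi_ge_1 n xi chi a); try easy; lra).
  assert (Hv : 0 <= dlog chi t) by (apply (dlog_chi_nonneg n xi chi); try easy; lra).
  assert (Hq : dlog xi t * dlog chi t <= dlog xi r * dlog chi r).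
  { apply (ambient_SC2 _ _ _ H); lra. }
  nra.
Qed.

(** * Differentiating a function given implicitly *)

Lemma is_derive_eps (f : R -> R) (x l : R) :
  is_derive f x l <->
  (forall eps, 0 < eps -> exists d, 0 < d /\
     forall h, Rabs h < d -> Rabs (f (x + h) - f x - l * h) <= eps * Rabs h).
Proof.
  rewrite is_derive_Reals. split.
  - intros H eps He. destruct (H eps He) as [d Hd]. exists d. split; [apply cond_pos|].
    intros h Hh. destruct (Req_dec h 0) as [->|Hn].
    + rewrite Rplus_0_r, Rmult_0_r, Rabs_R0. replace (f x - f x - 0) with 0 by ring.
      rewrite Rabs_R0. lra.
    + specialize (Hd h Hn Hh).
      replace (f (x + h) - f x - l * h) with (((f (x + h) - f x) / h - l) * h) by (field; easy).
      rewrite Rabs_mult. apply Rmult_le_compat_r; [apply Rabs_pos|lra].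
  - intros H eps He. destruct (H (eps / 2)) as (d & Hd & Hb); [lra|].
    exists (mkposreal d Hd). intros h Hn Hh. specialize (Hb h Hh).
    pose proof (Rabs_pos_lt h Hn).
    replace ((f (x + h) - f x) / h - l) with ((f (x + h) - f x - l * h) * / h) by (field; easy).
    rewrite Rabs_mult, Rabs_inv.
    apply Rle_lt_trans with (eps / 2 * Rabs h * / Rabs h).
    + apply Rmult_le_compat_r; [apply Rlt_le, Rinv_0_lt_compat; easy|easy].
    + rewrite Rmult_assoc, Rinv_r by lra. lra.
Qed.

(** [Gamma] is known only through f(Gamma), with no regularity of its own. Strict monotonicity of f
    gives continuity of G, after which the two first-order expansions of f(G) can be compared. *)
Lemma derive_of_composite (f G : R -> R) (r0 l d : R) :
  (forall x z, 0 <= x < z -> z < 1 -> f x < f z) ->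
  locally r0 (fun r => 0 <= G r < 1) -> 0 < G r0 ->
  0 < d -> is_derive f (G r0) d -> is_derive (fun r => f (G r)) r0 l ->
  is_derive G r0 (l / d).
Proof.
  intros Hinc HG HG0 Hd Hf HF.
  assert (HG1 : G r0 < 1) by (apply (locally_singleton _ _ HG)).
  assert (Hcont : forall e, 0 < e -> e < G r0 -> e < 1 - G r0 ->
            locally r0 (fun r => Rabs (G r - G r0) < e)).
  { intros e He He1 He2.
    assert (L1 : f (G r0 - e) < f (G r0)) by (apply Hinc; lra).
    assert (L2 : f (G r0) < f (G r0 + e)) by (apply Hinc; lra).
    assert (C : continuous (fun r => f (G r)) r0).
    { apply (ex_derive_continuous (fun r => f (G r))). now exists l. }
    assert (C1 := C (fun t => f (G r0 - e) < t) (open_gt _ _ L1)).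
    assert (C2 := C (fun t => t < f (G r0 + e)) (open_lt _ _ L2)).
    unfold filtermap in C1, C2.
    generalize (filter_and _ _ HG (filter_and _ _ C1 C2)).
    apply filter_imp. intros r (Hr & Hr1 & Hr2). apply Rabs_def1.
    - destruct (Rlt_or_le (G r - G r0) e) as [|Hc]; [easy|exfalso].
      destruct (Req_dec (G r) (G r0 + e)) as [E|E]; [rewrite E in Hr2; lra|].
      assert (f (G r0 + e) < f (G r)) by (apply Hinc; lra). lra.
    - destruct (Rlt_or_le (- e) (G r - G r0)) as [|Hc]; [easy|exfalso].
      destruct (Req_dec (G r) (G r0 - e)) as [E|E]; [rewrite E in Hr1; lra|].
      assert (f (G r) < f (G r0 - e)) by (apply Hinc; lra). lra. }
  rewrite is_derive_eps in Hf, HF |- *.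
  intros eps Heps.
  set (N := Rabs l + 1).
  assert (HN : 1 <= N) by (unfold N; pose proof (Rabs_pos l); lra).
  (* The tolerance d/2 absorbs half of d |g| and yields the a priori bound |g| <= 2 N |h| / d; with
     it, the tolerance d^2 eps / (4 N) contributes at most d eps |h| / 2, the same share as the
     error of the composite. *)
  assert (He2 : 0 < Rmin (d / 2) (d ^ 2 * eps / (4 * N))).
  { apply Rmin_glb_lt; [lra|]. apply Rdiv_lt_0_compat; [|lra].
    apply Rmult_lt_0_compat; [apply pow_lt; easy|easy]. }
  assert (He1 : 0 < Rmin 1 (d * eps / 2)).
  { apply Rmin_glb_lt; [lra|]. apply Rdiv_lt_0_compat; [|lra].
    apply Rmult_lt_0_compat; easy. }
  destruct (Hf _ He2) as (d2 & Hd2 & Hf2).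
  destruct (HF _ He1) as (d1 & Hd1 & Hf1).
  assert (He : 0 < Rmin d2 (Rmin (G r0 / 2) ((1 - G r0) / 2))).
  { repeat apply Rmin_glb_lt; lra. }
  destruct (Hcont (Rmin d2 (Rmin (G r0 / 2) ((1 - G r0) / 2)))) as [d3 Hd3]; [easy| | |].
  { eapply Rle_lt_trans; [eapply Rle_trans; [apply Rmin_r|apply Rmin_l]|lra]. }
  { eapply Rle_lt_trans; [eapply Rle_trans; [apply Rmin_r|apply Rmin_r]|lra]. }
  exists (Rmin d1 d3). split; [apply Rmin_glb_lt; [easy|apply cond_pos]|].
  intros h Hh. apply Rmin_Rgt in Hh. destruct Hh as [Hh1 Hh3].
  set (g := G (r0 + h) - G r0).
  assert (Hg : Rabs g < d2).
  { eapply Rlt_le_trans; [|apply Rmin_l]. apply Hd3.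
    unfold ball; simpl; unfold AbsRing_ball, abs, minus, plus, opp; simpl.
    replace (r0 + h + - r0) with h by ring. easy. }
  specialize (Hf1 h Hh1). specialize (Hf2 g Hg).
  unfold g in Hf2. replace (G r0 + (G (r0 + h) - G r0)) with (G (r0 + h)) in Hf2 by ring.
  fold g in Hf2.
  set (Df := f (G (r0 + h)) - f (G r0)) in *.
  assert (T1 : Rabs (Df - d * g) <= d / 2 * Rabs g).
  { eapply Rle_trans; [apply Hf2|]. apply Rmult_le_compat_r; [apply Rabs_pos|apply Rmin_l]. }
  assert (T2 : Rabs (Df - d * g) <= d ^ 2 * eps / (4 * N) * Rabs g).
  { eapply Rle_trans; [apply Hf2|]. apply Rmult_le_compat_r; [apply Rabs_pos|apply Rmin_r]. }
  assert (T3 : Rabs (Df - l * h) <= 1 * Rabs h).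
  { eapply Rle_trans; [apply Hf1|]. apply Rmult_le_compat_r; [apply Rabs_pos|apply Rmin_l]. }
  assert (T4 : Rabs (Df - l * h) <= d * eps / 2 * Rabs h).
  { eapply Rle_trans; [apply Hf1|]. apply Rmult_le_compat_r; [apply Rabs_pos|apply Rmin_r]. }
  assert (T5 : d / 2 * Rabs g <= N * Rabs h).
  { assert (d * Rabs g <= Rabs (Df - d * g) + Rabs (Df - l * h) + Rabs l * Rabs h).
    { rewrite <- (Rabs_right d) at 1 by lra. rewrite <- (Rabs_mult l), <- Rabs_mult.
      replace (d * g) with (- (Df - d * g) + (Df - l * h) + l * h) at 1 by ring.
      eapply Rle_trans; [apply Rabs_triang|]. apply Rplus_le_compat_r.
      eapply Rle_trans; [apply Rabs_triang|]. rewrite Rabs_Ropp. lra. }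
    unfold N. lra. }
  assert (T6 : d * Rabs (g - l / d * h) <= d * (eps * Rabs h)).
  { rewrite <- (Rabs_right d) at 1 by lra. rewrite <- Rabs_mult.
    replace (d * (g - l / d * h)) with (- (Df - d * g) + (Df - l * h)) by (field; lra).
    eapply Rle_trans; [apply Rabs_triang|]. rewrite Rabs_Ropp.
    assert (d ^ 2 * eps / (4 * N) * Rabs g <= d * eps / 2 * Rabs h); [|lra].
    replace (d ^ 2 * eps / (4 * N) * Rabs g) with (d * eps / (2 * N) * (d / 2 * Rabs g)) by (field; lra).
    replace (d * eps / 2 * Rabs h) with (d * eps / (2 * N) * (N * Rabs h)) by (field; lra).
    apply Rmult_le_compat_l; [|easy].
    apply Rlt_le, Rdiv_lt_0_compat; [nra|lra]. }
  apply Rmult_le_reg_l in T6; easy.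
Qed.

(** * The function f for alpha = 1/k *)

Lemma rpow_INR (x : R) (k : nat) : 0 <= x -> (1 <= k)%nat -> rpow x (INR k) = x ^ k.
Proof.
  intros Hx Hk. unfold rpow. destruct (Rle_dec x 0) as [H|H].
  - replace x with 0 by lra. rewrite pow_i; [easy|lia].
  - apply Rpower_pow; lra.
Qed.

Lemma Rpower_neg_half (x : R) (m : nat) :
  0 < x -> Rpower x (- (INR m / 2)) = / sqrt x ^ m.
Proof.
  intros Hx. rewrite Rpower_Ropp. f_equal.
  replace (INR m / 2) with (/ 2 * INR m) by field.
  rewrite <- Rpower_mult, Rpower_sqrt by easy.
  apply Rpower_pow, sqrt_lt_R0; easy.
Qed.

Lemma f_sol_pow (k m : nat) (x : R) :
  (1 <= k)%nat -> 0 <= x < 1 ->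
  f_sol m (/ INR k) x = x ^ k / sqrt (1 - x ^ 2) ^ m.
Proof.
  intros Hk Hx. unfold f_sol.
  rewrite Rinv_inv, rpow_INR by (easy || lra).
  rewrite Rpower_neg_half by nra. easy.
Qed.

(** f(x)/x = x^(k-1) (1 - x^2)^(-m/2) is a product of nondecreasing factors; the cross-multiplied
    form includes x = 0. *)
Lemma f_sol_ratio (k m : nat) (x z : R) :
  (1 <= k)%nat -> 0 <= x <= z -> z < 1 ->
  f_sol m (/ INR k) x * z <= f_sol m (/ INR k) z * x.
Proof.
  intros Hk Hx Hz. rewrite !f_sol_pow by (easy || lra).
  assert (Hs : 0 < sqrt (1 - z ^ 2) <= sqrt (1 - x ^ 2)).
  { split; [apply sqrt_lt_R0; nra|apply sqrt_le_1; nra]. }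
  assert (Hi : / sqrt (1 - x ^ 2) ^ m <= / sqrt (1 - z ^ 2) ^ m).
  { apply Rinv_le_contravar; [apply pow_lt; easy|apply pow_incr; lra]. }
  assert (Hi0 : 0 < / sqrt (1 - x ^ 2) ^ m) by (apply Rinv_0_lt_compat, pow_lt; lra).
  destruct k as [|k]; [lia|]. simpl (_ ^ S k). unfold Rdiv.
  assert (Hp : 0 <= x ^ k <= z ^ k) by (split; [apply pow_le; lra|apply pow_incr; lra]).
  replace (x * x ^ k * / sqrt (1 - x ^ 2) ^ m * z) with (x * z * (x ^ k * / sqrt (1 - x ^ 2) ^ m)) by ring.
  replace (z * z ^ k * / sqrt (1 - z ^ 2) ^ m * x) with (x * z * (z ^ k * / sqrt (1 - z ^ 2) ^ m)) by ring.
  apply Rmult_le_compat_l; [nra|]. apply Rmult_le_compat; lra.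
Qed.

Lemma f_sol_pos (m : nat) (alpha x : R) : 0 < x -> 0 < f_sol m alpha x.
Proof.
  intros Hx. unfold f_sol, rpow. destruct (Rle_dec x 0); [lra|].
  apply Rmult_lt_0_compat; apply exp_pos.
Qed.

Lemma f_sol_0 (m : nat) (alpha : R) : f_sol m alpha 0 = 0.
Proof.
  unfold f_sol, rpow. destruct (Rle_dec 0 0); [ring|lra].
Qed.

Lemma f_sol_incr (k m : nat) (x z : R) :
  (1 <= k)%nat -> 0 <= x < z -> z < 1 ->
  f_sol m (/ INR k) x < f_sol m (/ INR k) z.
Proof.
  intros Hk Hx Hz.
  assert (Hr := f_sol_ratio k m x z Hk).
  assert (Hp : 0 < f_sol m (/ INR k) z) by (apply f_sol_pos; lra).
  specialize (Hr ltac:(lra) Hz). nra.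
Qed.

(** The logarithmic derivative is k/x + m x/(1 - x^2). Over a common denominator its numerator is k
    (1 + x^2 (m alpha - 1)) with alpha = 1/k, the source of the denominator in the condition on
    h. *)
Lemma is_derive_f_sol (k m : nat) (x : R) :
  0 < x < 1 ->
  is_derive (f_sol m (/ INR k)) x
    (f_sol m (/ INR k) x * ((INR k * (1 - x ^ 2) + INR m * x ^ 2) / (x * (1 - x ^ 2)))).
Proof.
  intros Hx.
  assert (E : forall t, 0 < t -> exp (INR k * ln t + - (INR m / 2) * ln (1 - t ^ 2)) = f_sol m (/ INR k) t).
  { intros t Ht. unfold f_sol, rpow, Rpower. destruct (Rle_dec t 0); [lra|].
    rewrite Rinv_inv, exp_plus. easy. }
  apply (is_derive_ext_loc (fun t => exp (INR k * ln t + - (INR m / 2) * ln (1 - t ^ 2)))).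
  { apply (filter_imp (fun t => 0 < t)); [exact E|]. apply (open_gt 0 x); lra. }
  rewrite <- E by lra.
  auto_derive; [split; [lra|split; [nra|easy]]|].
  simpl. replace (1 + - (x * (x * 1))) with (1 - x * (x * 1)) by ring. field. split; nra.
Qed.

(** * The rate at which y is attracted to Gamma *)

Lemma pow_lt_pow (x y : R) (n : nat) : 0 <= x < y -> (1 <= n)%nat -> x ^ n < y ^ n.
Proof.
  intros Hxy Hn. destruct n as [|n]; [lia|]. simpl.
  assert (x ^ n <= y ^ n) by (apply pow_incr; lra).
  assert (0 < y ^ n) by (apply pow_lt; lra).
  assert (0 <= x ^ n) by (apply pow_le; lra). nra.
Qed.

(* The soliton equation reads
   A u^(m-1) dy/dr = - X^k (1 - y^2) / y (f y - f Gamma),  X = c chi, u = xi'/xi,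
   and f y - f Gamma is at least f y / y (y - Gamma); this bounds from below the
   resulting rate of attraction of y to Gamma. *)
Lemma attraction_rate (k m : nat) (beta u1 X1 : R) :
  (2 <= m)%nat -> k = m \/ k = 1%nat -> 0 < beta <= 1 -> 0 < u1 -> 0 < X1 ->
  exists kappa : R, 0 < kappa /\
    forall u X g x : R, 0 < u <= u1 -> X1 <= X -> 0 < g <= x -> x < 1 ->
      beta * u ^ m <= X ^ k * f_sol m (/ INR k) g ->
      kappa * u ^ (m - 1) * x ^ 2 <= X ^ k * ((1 - x ^ 2) * f_sol m (/ INR k) x).
Proof.
  intros Hm Hk Hb Hu1 HX1. destruct m as [|[|m]]; [lia|lia|].
  replace (S (S m) - 1)%nat with (S m) by lia.
  assert (Hs : forall x, 0 < x < 1 -> 0 < sqrt (1 - x ^ 2) <= 1).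
  { intros x Hx. split; [apply sqrt_lt_R0; nra|].
    apply Rle_trans with (sqrt 1); [apply sqrt_le_1; nra|rewrite sqrt_1; lra]. }
  assert (Hs2 : forall x, 0 < x < 1 -> 1 - x ^ 2 = sqrt (1 - x ^ 2) ^ 2).
  { intros x Hx. rewrite pow2_sqrt; nra. }
  destruct Hk as [->| ->].
  (* Here [m] is two less than the original exponent. With s = sqrt(1 - x^2) and t = x/s, the
     right-hand side equals X^2 (X t)^m x^2, and X t >= beta u; one further power of u is paid for
     by u <= [u1]. *)
  - exists (beta ^ m * X1 ^ 2 / u1). split.
    { apply Rdiv_lt_0_compat; [|easy]. apply Rmult_lt_0_compat; apply pow_lt; lra. }
    intros u X g x Hu HX Hg Hx HS.
    rewrite f_sol_pow in * by (lia || lra).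
    assert (Hsx := Hs x ltac:(lra)). assert (Hsg := Hs g ltac:(lra)).
    assert (Hssx := Hs2 x ltac:(lra)).
    assert (Hsgx : sqrt (1 - x ^ 2) <= sqrt (1 - g ^ 2)) by (apply sqrt_le_1; nra).
    set (s := sqrt (1 - x ^ 2)) in *. set (sg := sqrt (1 - g ^ 2)) in *.
    rewrite Hssx.
    set (t := x / s). set (tg := g / sg).
    assert (Htg : 0 < tg) by (apply Rdiv_lt_0_compat; lra).
    assert (Ht : tg <= t).
    { unfold t, tg, Rdiv. apply Rmult_le_compat; try lra.
      - apply Rlt_le, Rinv_0_lt_compat; lra.
      - apply Rinv_le_contravar; lra. }
    (* A root of the hypothesis on [g]: since beta <= 1, a power of beta is at most beta. *)
    assert (HXt : beta * u <= X * tg).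
    { destruct (Rle_or_lt (beta * u) (X * tg)) as [|Hlt]; [easy|exfalso].
      assert (Hl : (X * tg) ^ S (S m) < (beta * u) ^ S (S m)).
      { apply pow_lt_pow; [split; [nra|easy]|lia]. }
      rewrite !Rpow_mult_distr in Hl.
      unfold tg, Rdiv in Hl. rewrite (Rpow_mult_distr g), pow_inv in Hl.
      assert (beta ^ S (S m) <= beta).
      { assert (beta ^ S m <= 1) by (rewrite <- (pow1 (S m)); apply pow_incr; lra).
        change (beta ^ S (S m)) with (beta * beta ^ S m). nra. }
      assert (0 < u ^ S (S m)) by (apply pow_lt; lra).
      assert (beta ^ S (S m) * u ^ S (S m) <= beta * u ^ S (S m)) by (apply Rmult_le_compat_r; lra).
      unfold Rdiv in HS. lra. }
    assert (HXt' : (beta * u) ^ m <= (X * t) ^ m).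
    { apply pow_incr. split; [nra|]. apply Rle_trans with (X * tg); [easy|].
      apply Rmult_le_compat_l; lra. }
    replace (X ^ S (S m) * (s ^ 2 * (x ^ S (S m) / s ^ S (S m)))) with (X ^ 2 * (X * t) ^ m * x ^ 2).
    2: { unfold t, Rdiv. rewrite !Rpow_mult_distr, pow_inv. simpl. field.
         split; [|lra]. apply pow_nonzero; lra. }
    apply Rmult_le_compat_r; [apply pow2_ge_0|].
    apply Rle_trans with (X1 ^ 2 * (beta * u) ^ m).
    2: { apply Rmult_le_compat; [apply pow2_ge_0|apply pow_le; nra| |easy]. apply pow_incr; lra. }
    rewrite Rpow_mult_distr.
    replace (beta ^ m * X1 ^ 2 / u1 * u ^ S m) with (X1 ^ 2 * (beta ^ m * u ^ m) * (u / u1)) by (simpl; field; lra).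
    rewrite <- (Rmult_1_r (X1 ^ 2 * (beta ^ m * u ^ m))) at 2.
    apply Rmult_le_compat_l.
    { repeat apply Rmult_le_pos; try apply pow_le; lra. }
    apply (Rmult_le_reg_r u1); [easy|]. unfold Rdiv. rewrite Rmult_assoc, Rinv_l; lra.
  (* For k = 1 the right-hand side is X x / s^m with s <= 1, hence at least [X1] x^2. *)
  - exists (X1 / u1 ^ S m). split.
    { apply Rdiv_lt_0_compat; [easy|apply pow_lt; easy]. }
    intros u X g x Hu HX Hg Hx _.
    rewrite f_sol_pow by (lia || lra).
    assert (Hsx := Hs x ltac:(lra)). assert (Hssx := Hs2 x ltac:(lra)).
    set (s := sqrt (1 - x ^ 2)) in *. rewrite Hssx.
    assert (Hsm : 1 <= / s ^ m).
    { rewrite <- Rinv_1. apply Rinv_le_contravar; [apply pow_lt; lra|].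
      rewrite <- (pow1 m). apply pow_incr; lra. }
    replace (s ^ 2 * (x ^ 1 / s ^ S (S m))) with (x * / s ^ m).
    2: { simpl. field. split; [|lra]. apply pow_nonzero; lra. }
    assert (Hu' : u ^ S m <= u1 ^ S m) by (apply pow_incr; lra).
    assert (Hup : 0 < u1 ^ S m) by (apply pow_lt; lra).
    apply Rle_trans with (X1 * (x * 1)).
    2: { rewrite pow_1. apply Rmult_le_compat; try lra. apply Rmult_le_compat_l; lra. }
    apply Rle_trans with (X1 * x ^ 2); [|apply Rmult_le_compat_l; nra].
    apply Rmult_le_compat_r; [apply pow2_ge_0|].
    apply (Rmult_le_reg_r (u1 ^ S m)); [easy|].
    replace (X1 / u1 ^ S m * u ^ S m * u1 ^ S m) with (X1 * u ^ S m) by (field; lra).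
    apply Rmult_le_compat_l; lra.
Qed.

(** By [f_sol_ratio], |f y - f g| is at least f(x)/x times |y - g| with x = max(y, g). The rate
    hypothesis is applied at that x; if y < g, also 1 - y^2 >= 1 - g^2 is used. *)
Lemma attraction (k m : nat) (Z X g y : R) :
  (1 <= k)%nat -> 0 <= Z -> 0 < X -> 0 < g < 1 -> 0 <= y < 1 ->
  (forall x, g <= x < 1 -> Z * x ^ 2 <= X ^ k * ((1 - x ^ 2) * f_sol m (/ INR k) x)) ->
  Z * y * (y - g) ^ 2 <=
  X ^ k * (1 - y ^ 2) * (f_sol m (/ INR k) y - f_sol m (/ INR k) g) * (y - g).
Proof.
  intros Hk HZ HX Hg Hy Hrate.
  assert (HXk : 0 < X ^ k) by (apply pow_lt; easy).
  set (f := f_sol m (/ INR k)) in *.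
  destruct (Rle_or_lt g y) as [Hgy|Hgy].
  - assert (Hr : f g * y <= f y * g) by (apply f_sol_ratio; lra || easy).
    specialize (Hrate y ltac:(lra)).
    apply (Rmult_le_reg_l y); [lra|].
    apply Rle_trans with (X ^ k * ((1 - y ^ 2) * f y) * (y - g) ^ 2).
    + replace (y * (Z * y * (y - g) ^ 2)) with (Z * y ^ 2 * (y - g) ^ 2) by ring.
      apply Rmult_le_compat_r; [apply pow2_ge_0|easy].
    + replace (X ^ k * ((1 - y ^ 2) * f y) * (y - g) ^ 2)
        with (X ^ k * (1 - y ^ 2) * (y - g) * (f y * (y - g))) by ring.
      replace (y * (X ^ k * (1 - y ^ 2) * (f y - f g) * (y - g)))
        with (X ^ k * (1 - y ^ 2) * (y - g) * (f y * y - f g * y)) by ring.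
      apply Rmult_le_compat_l; [|nra].
      apply Rmult_le_pos; [|lra]. apply Rmult_le_pos; [lra|nra].
  - assert (Hr : f y * g <= f g * y) by (apply f_sol_ratio; lra || easy).
    specialize (Hrate g ltac:(lra)).
    apply Rle_trans with (Z * g * (y - g) ^ 2).
    { apply Rmult_le_compat_r; [apply pow2_ge_0|]. apply Rmult_le_compat_l; lra. }
    apply (Rmult_le_reg_l g); [lra|].
    apply Rle_trans with (X ^ k * ((1 - g ^ 2) * f g) * (y - g) ^ 2).
    + replace (g * (Z * g * (y - g) ^ 2)) with (Z * g ^ 2 * (y - g) ^ 2) by ring.
      apply Rmult_le_compat_r; [apply pow2_ge_0|easy].
    + assert (Hfg : 0 < f g) by (apply f_sol_pos; lra).
      replace (X ^ k * ((1 - g ^ 2) * f g) * (y - g) ^ 2)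
        with (X ^ k * (g - y) * ((1 - g ^ 2) * (f g * (g - y)))) by ring.
      replace (g * (X ^ k * (1 - y ^ 2) * (f y - f g) * (y - g)))
        with (X ^ k * (g - y) * ((1 - y ^ 2) * (f g * g - f y * g))) by ring.
      apply Rmult_le_compat_l; [nra|].
      apply Rmult_le_compat; nra.
Qed.

(** * Lower bound for the mean curvature of cylinders, and the derivative of Gamma *)

Lemma binom_pos (n k : nat) : (k <= n)%nat -> 0 < binom n k.
Proof.
  intros H. unfold binom. replace (k <=? n)%nat with true by (symmetry; apply Nat.leb_le; easy).
  unfold Binomial.C. apply Rdiv_lt_0_compat; [apply INR_fact_lt_0|].
  apply Rmult_lt_0_compat; apply INR_fact_lt_0.
Qed.

Lemma binom_nonneg (n k : nat) : 0 <= binom n k.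
Proof.
  destruct (le_lt_dec k n) as [H|H]; [apply Rlt_le, binom_pos; easy|].
  unfold binom. replace (k <=? n)%nat with false by (symmetry; apply Nat.leb_gt; easy). lra.
Qed.

(** If m <= n - 1, the xi'/xi term has a positive coefficient. If m = n, that coefficient is 0 and
    only chi'/chi is left; by rigidity it equals 1/u, which is at least u / u1^2 because u <= [u1].
    The cap beta <= 1 serves the root extraction in [attraction_rate]. *)
Lemma S_cyl_lower (n m : nat) (xi chi : R -> R) :
  ambient_space n xi chi ->
  ((2 <= m <= n - 1)%nat \/
   (m = n /\ ~ X_parallel chi /\ hyperbolic_model inv_remainder xi chi)) ->
  exists beta : R, 0 < beta <= 1 /\ forall r, 1 <= r ->
    beta * dlog xi r <= binom (n - 1) (m - 1) * dlog chi r + binom (n - 1) m * dlog xi r.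
Proof.
  intros H [Hm|(-> & _ & Hh)].
  - assert (HA := binom_nonneg (n - 1) (m - 1)).
    assert (HB : 0 < binom (n - 1) m) by (apply binom_pos; lia).
    exists (Rmin 1 (binom (n - 1) m)). split.
    { split; [apply Rmin_glb_lt; lra|apply Rmin_l]. }
    intros r Hr. assert (Hv := dlog_chi_nonneg n xi chi r H ltac:(lra)).
    assert (Hu := dlog_xi_pos n xi chi r H ltac:(lra)).
    assert (Rmin 1 (binom (n - 1) m) <= binom (n - 1) m) by apply Rmin_r. nra.
  - assert (Hn := ambient_dim _ _ _ H).
    assert (HB := binom_nonneg (n - 1) n).
    assert (HA : 0 < binom (n - 1) (n - 1)) by (apply binom_pos; lia).
    assert (Hu1 := dlog_xi_pos n xi chi 1 H ltac:(lra)).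
    set (A := binom (n - 1) (n - 1)) in *. set (u1 := dlog xi 1) in *.
    exists (Rmin 1 (A / u1 ^ 2)). split.
    { split; [|apply Rmin_l]. apply Rmin_glb_lt; [lra|].
      apply Rdiv_lt_0_compat; [easy|apply pow_lt; easy]. }
    intros r Hr.
    assert (Hu := dlog_xi_pos n xi chi r H ltac:(lra)).
    assert (Huv := hyperbolic_rigidity n xi chi r H Hh ltac:(lra)).
    assert (Hle : dlog xi r <= u1) by (apply (dlog_xi_le n xi chi); [easy|lra]).
    apply Rle_trans with (A * dlog chi r); [|nra].
    apply Rle_trans with (A / u1 ^ 2 * dlog xi r).
    { apply Rmult_le_compat_r; [lra|apply Rmin_r]. }
    replace (dlog chi r) with (/ dlog xi r) by (apply (Rmult_eq_reg_l (dlog xi r)); [rewrite Rinv_r|]; lra).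
    apply (Rmult_le_reg_r (dlog xi r * u1 ^ 2)); [apply Rmult_lt_0_compat; [lra|apply pow_lt; lra]|].
    replace (A / u1 ^ 2 * dlog xi r * (dlog xi r * u1 ^ 2)) with (A * dlog xi r ^ 2) by (field; lra).
    replace (A * / dlog xi r * (dlog xi r * u1 ^ 2)) with (A * u1 ^ 2) by (field; lra).
    apply Rmult_le_compat_l; [lra|]. apply pow_incr; lra.
Qed.

Lemma is_derive_log_chi_over_S (n m k : nat) (xi chi : R -> R) (r : R) :
  ambient_space n xi chi -> (2 <= m)%nat ->
  let A := binom (n - 1) (m - 1) in
  let B := binom (n - 1) m in
  (forall t, 1 <= t -> 0 < A * dlog chi t + B * dlog xi t) ->
  1 < r ->
  is_derive (fun t => ln (Rpower (chi t) (INR k) / S_cyl n m xi chi t)) r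
    (INR k * dlog chi r
     - (A * ddlog chi r
        + B * ddlog xi r)
       / (A * dlog chi r + B * dlog xi r)
     - (INR m - 1) * (ddlog xi r / dlog xi r)).
Proof.
  intros H Hm A B HS Hr.
  assert (E : forall t, 1 < t ->
    INR k * ln (chi t) - ln (A * dlog chi t + B * dlog xi t) - (INR m - 1) * ln (dlog xi t)
    = ln (Rpower (chi t) (INR k) / S_cyl n m xi chi t)).
  { intros t Ht.
    assert (Hu := dlog_xi_pos n xi chi t H ltac:(lra)).
    assert (Hw := HS t ltac:(lra)).
    unfold S_cyl. fold A B.
    rewrite ln_div, ln_mult, ln_pow; try easy.
    - unfold Rpower. rewrite ln_exp, minus_INR by lia. simpl (INR 1). ring.
    - apply pow_lt; easy.
    - apply exp_pos.
    - apply Rmult_lt_0_compat; [easy|apply pow_lt; easy]. }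
  apply (is_derive_ext_loc (fun t => INR k * ln (chi t) - ln (A * dlog chi t + B * dlog xi t)
                                     - (INR m - 1) * ln (dlog xi t))).
  { apply (filter_imp (fun t => 1 < t)); [exact E|apply (open_gt 1 r Hr)]. }
  assert (Hu := dlog_xi_pos n xi chi r H ltac:(lra)).
  assert (Hw := HS r ltac:(lra)).
  assert (Dc := is_derive_dlog chi r (ambient_chi_smooth _ _ _ H) ltac:(lra)
                  (ambient_chi_pos _ _ _ H r ltac:(lra))).
  assert (Dx := is_derive_dlog xi r (ambient_xi_smooth _ _ _ H) ltac:(lra)
                  (ambient_xi_pos _ _ _ H r ltac:(lra))).
  apply (is_derive_minus (fun t => INR k * ln (chi t) - ln (A * dlog chi t + B * dlog xi t))
           (fun t => (INR m - 1) * ln (dlog xi t))).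
  - apply (is_derive_minus (fun t => INR k * ln (chi t)) (fun t => ln (A * dlog chi t + B * dlog xi t))).
    + apply (is_derive_scal (fun t => ln (chi t))). apply is_derive_ln_comp.
      * apply smooth_derive; [apply H|lra].
      * apply H; lra.
    + apply (is_derive_ln_comp (fun t => A * dlog chi t + B * dlog xi t)); [|easy].
      apply (is_derive_plus (fun t => A * dlog chi t) (fun t => B * dlog xi t)).
      * apply (is_derive_scal (dlog chi)), Dc.
      * apply (is_derive_scal (dlog xi)), Dx.
  - apply (is_derive_scal (fun t => ln (dlog xi t))).
    apply is_derive_ln_comp; [exact Dx|easy].
Qed.

(* Differentiating the logarithm of f(Gamma) = S / (c chi)^k. *)
Lemma is_derive_Gamma (n m k : nat) (c : R) (xi chi Gamma : R -> R) (r L : R) :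
  (1 <= k)%nat -> 0 < c ->
  (forall t, 1 <= t -> 0 < chi t) -> (forall t, 1 <= t -> 0 < S_cyl n m xi chi t) ->
  is_Gamma n m (/ INR k) c xi chi Gamma ->
  1 < r ->
  is_derive (fun t => ln (Rpower (chi t) (INR k) / S_cyl n m xi chi t)) r L ->
  0 < Gamma r /\
  is_derive Gamma r
    (- (/ INR k * (Gamma r * (1 - Gamma r ^ 2)
                  / (1 + Gamma r ^ 2 * (INR m * / INR k - 1)) * L))).
Proof.
  intros Hk Hc Hchi HS HG Hr HL.
  assert (HF : forall t, 1 <= t -> 0 <= Gamma t < 1 /\
            f_sol m (/ INR k) (Gamma t) = S_cyl n m xi chi t / Rpower (c * chi t) (INR k)).
  { intros t Ht. destruct (HG t) as [H1 H2]; [lra|]. rewrite Rinv_inv in H2. easy. }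
  assert (Hpos : forall t, 1 <= t -> 0 < Gamma t).
  { intros t Ht. destruct (HF t Ht) as [H1 H2].
    destruct (Req_dec (Gamma t) 0) as [E|E]; [|lra]. exfalso.
    rewrite E, f_sol_0 in H2.
    assert (0 < S_cyl n m xi chi t / Rpower (c * chi t) (INR k)); [|lra].
    apply Rdiv_lt_0_compat; [apply HS; easy|apply exp_pos]. }
  split; [apply Hpos; lra|].
  destruct (HF r) as [Hr1 Hr2]; [lra|]. assert (Hr0 := Hpos r ltac:(lra)).
  assert (Hk' : 1 <= INR k) by (apply (le_INR 1); easy).
  assert (Hm' := pos_INR m).
  assert (Hcomp : is_derive (fun t => f_sol m (/ INR k) (Gamma t)) r (- L * f_sol m (/ INR k) (Gamma r))).
  { assert (E : forall t, 1 < t ->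
       / Rpower c (INR k) * exp (- ln (Rpower (chi t) (INR k) / S_cyl n m xi chi t))
       = f_sol m (/ INR k) (Gamma t)).
    { intros t Ht. destruct (HF t) as [_ ->]; [lra|].
      assert (P1 := HS t ltac:(lra)). assert (P2 := Hchi t ltac:(lra)).
      assert (P3 : 0 < Rpower (chi t) (INR k)) by apply exp_pos.
      assert (P4 : 0 < Rpower c (INR k)) by apply exp_pos.
      rewrite exp_Ropp, exp_ln by (apply Rdiv_lt_0_compat; easy).
      rewrite <- Rpower_mult_distr by easy. field. lra. }
    apply (is_derive_ext_loc (fun t =>
       / Rpower c (INR k) * exp (- ln (Rpower (chi t) (INR k) / S_cyl n m xi chi t)))).
    { apply (filter_imp (fun t => 1 < t)); [exact E|apply (open_gt 1 r Hr)]. }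
    rewrite <- E by easy.
    evar_last.
    { apply (is_derive_scal (fun t => exp (- ln (Rpower (chi t) (INR k) / S_cyl n m xi chi t)))).
      apply (is_derive_comp exp (fun t => - ln (Rpower (chi t) (INR k) / S_cyl n m xi chi t))).
      - apply is_derive_Reals, derivable_pt_lim_exp.
      - apply (is_derive_opp (fun t => ln (Rpower (chi t) (INR k) / S_cyl n m xi chi t))), HL. }
    unfold scal, opp; simpl; unfold mult; simpl. ring. }
  assert (Hf := f_sol_pos m (/ INR k) (Gamma r) Hr0).
  assert (HD := is_derive_f_sol k m (Gamma r) ltac:(lra)).
  set (f0 := f_sol m (/ INR k) (Gamma r)) in *.
  set (g := Gamma r) in *.
  assert (Hg2 : 0 < 1 - g ^ 2) by nra.
  assert (Hnum : 0 < INR k * (1 - g ^ 2) + INR m * g ^ 2).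
  { assert (0 <= INR m * g ^ 2) by (apply Rmult_le_pos; [easy|apply pow2_ge_0]). nra. }
  assert (Hd : 0 < f0 * ((INR k * (1 - g ^ 2) + INR m * g ^ 2) / (g * (1 - g ^ 2)))).
  { apply Rmult_lt_0_compat; [easy|]. apply Rdiv_lt_0_compat; [easy|].
    apply Rmult_lt_0_compat; easy. }
  evar_last.
  { apply (derive_of_composite (f_sol m (/ INR k)) Gamma r _ _) with (5 := HD) (6 := Hcomp).
    - intros x z Hx Hz. apply f_sol_incr; easy.
    - apply (filter_imp (fun t => 1 < t)); [|apply (open_gt 1 r Hr)].
      intros t Ht. apply HF; lra.
    - easy.
    - easy. }
  fold g. field. repeat split; try lra.
Qed.

(** * Contraction along an orbit *)

Lemma little_o_inf_eps (E g : R -> R) :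
  little_o_inf E g <->
  (forall eps, 0 < eps -> exists M, forall r, M < r -> Rabs (E r) <= eps * Rabs (g r)).
Proof.
  split.
  - intros H eps He. exact (H (mkposreal eps He)).
  - intros H eps. exact (H eps (cond_pos eps)).
Qed.

Lemma S_cyl_ge (n m : nat) (xi chi : R -> R) (beta r : R) :
  ambient_space n xi chi -> (2 <= m)%nat -> 0 < r ->
  beta * dlog xi r <= binom (n - 1) (m - 1) * dlog chi r + binom (n - 1) m * dlog xi r ->
  beta * dlog xi r ^ m <= S_cyl n m xi chi r.
Proof.
  intros H Hm Hr Hb. destruct m as [|m]; [lia|]. unfold S_cyl.
  assert (Hu := dlog_xi_pos n xi chi r H Hr).
  replace (dlog xi r ^ S m) with (dlog xi r * dlog xi r ^ (S m - 1)).
  2: { replace (S m - 1)%nat with m by lia. easy. }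
  rewrite <- Rmult_assoc. apply Rmult_le_compat_r; [apply pow_le; lra|easy].
Qed.

(** In the interior of I, rho' = cos phi >= 0 on Q_1. Endpoints of I are reached through one-sided
    continuity, by comparison with the midpoint. The lemma serves to order parameters by their
    radii. *)
Lemma orbit_rho_incr (n m : nat) (alpha c : R) (xi chi : R -> R)
    (I : R -> Prop) (rho phi : R -> R) (s t : R) :
  orbit_in_Q1 n m alpha c xi chi I rho phi ->
  I s -> I t -> s <= t -> rho s <= rho t.
Proof.
  intros (HI & Hcont & Hode) Is It Hst.
  destruct (Req_dec s t) as [->|Hne]; [lra|].
  assert (Hloc : forall x, s < x < t -> locally x I).
  { intros x Hx. apply (filter_imp (fun z => s < z /\ z < t)).
    - intros z Hz. apply (HI s t z Is It); lra.
    - apply filter_and; [apply (open_gt s x)|apply (open_lt t x)]; lra. }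
  assert (Hint : forall x z, s < x -> x <= z -> z < t -> rho x <= rho z).
  { intros x z Hx Hxz Hz.
    assert (- rho z <= - rho x); [|lra].
    apply (nonincreasing_of_derive (fun w => - rho w) (fun w => - cos (phi w))); [easy| |].
    - intros w Hw. apply (is_derive_opp rho). apply Hode, Hloc; lra.
    - intros w Hw. destruct (Hcont w) as (_ & Hphi & _).
      + apply (HI s t w Is It); lra.
      + assert (0 <= cos (phi w)); [|lra]. apply cos_ge_0; lra. }
  set (mid := (s + t) / 2).
  apply Rle_trans with (rho mid).
  - destruct (Rle_or_lt (rho s) (rho mid)) as [|Hlt]; [easy|exfalso].
    destruct (Hcont s Is) as (_ & _ & Hc & _).
    destruct (Hc _ (open_gt _ _ Hlt)) as [d Hd].
    pose proof (cond_pos d) as Hdp.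
    set (x := s + Rmin (d / 2) ((t - s) / 2)).
    assert (Hx1 : 0 < Rmin (d / 2) ((t - s) / 2)) by (apply Rmin_glb_lt; lra).
    assert (Hx2 := Rmin_l (d / 2) ((t - s) / 2)).
    assert (Hx3 := Rmin_r (d / 2) ((t - s) / 2)).
    assert (rho mid < rho x).
    { apply Hd.
      - unfold ball; simpl; unfold AbsRing_ball, abs, minus, plus, opp; simpl.
        rewrite Rabs_right; unfold x; lra.
      - apply (HI s t x Is It). unfold x; lra. }
    assert (rho x <= rho mid) by (apply Hint; unfold x, mid; lra). lra.
  - destruct (Rle_or_lt (rho mid) (rho t)) as [|Hlt]; [easy|exfalso].
    destruct (Hcont t It) as (_ & _ & Hc & _).
    destruct (Hc _ (open_lt _ _ Hlt)) as [d Hd].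
    pose proof (cond_pos d) as Hdp.
    set (x := t - Rmin (d / 2) ((t - s) / 2)).
    assert (Hx1 : 0 < Rmin (d / 2) ((t - s) / 2)) by (apply Rmin_glb_lt; lra).
    assert (Hx2 := Rmin_l (d / 2) ((t - s) / 2)).
    assert (Hx3 := Rmin_r (d / 2) ((t - s) / 2)).
    assert (rho x < rho mid).
    { apply Hd.
      - unfold ball; simpl; unfold AbsRing_ball, abs, minus, plus, opp; simpl.
        rewrite Rabs_left; unfold x; lra.
      - apply (HI s t x Is It). unfold x; lra. }
    assert (rho mid <= rho x) by (apply Hint; unfold x, mid; lra). lra.
Qed.

(** The left-hand factor - sin phi phi' is dy/dtau. Substituting S_m = X^k f(Gamma) and y^k = f(y)
    sin^m phi brings the system to the form treated by [attraction]. *)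
Lemma orbit_attraction (n m k : nat) (c kappa : R) (xi chi Gamma : R -> R)
    (I : R -> Prop) (rho phi : R -> R) (tau : R) :
  ambient_space n xi chi -> 0 < c -> (2 <= m <= n)%nat -> (1 <= k)%nat -> 0 < kappa ->
  is_Gamma n m (/ INR k) c xi chi Gamma ->
  orbit_in_Q1 n m (/ INR k) c xi chi I rho phi ->
  locally tau I ->
  0 < Gamma (rho tau) ->
  (forall x, Gamma (rho tau) <= x < 1 ->
     kappa * dlog xi (rho tau) ^ (m - 1) * x ^ 2
     <= (c * chi (rho tau)) ^ k * ((1 - x ^ 2) * f_sol m (/ INR k) x)) ->
  let y := cos (phi tau) in
  (y - Gamma (rho tau)) * (- sin (phi tau) * Derive phi tau)
  <= - (kappa / binom (n - 1) (m - 1)) * y * (y - Gamma (rho tau)) ^ 2.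
Proof.
  intros H Hc Hm Hk Hkap HG (_ & Hcont & Hode) Htau HGp Hrate y.
  destruct (Hcont tau (locally_singleton _ _ Htau)) as (Hrho & Hphi & _).
  destruct (Hode tau Htau) as (_ & _ & Heq).
  destruct (HG (rho tau) Hrho) as [HG1 HG2].
  assert (HA : 0 < binom (n - 1) (m - 1)) by (apply binom_pos; lia).
  assert (HX : 0 < c * chi (rho tau)).
  { apply Rmult_lt_0_compat; [easy|apply H; easy]. }
  assert (Hsin : 0 < sin (phi tau)) by (apply sin_gt_0; pose proof PI_RGT_0; lra).
  assert (Hy0 : 0 <= y) by (apply cos_ge_0; lra).
  assert (Hsc : 1 - y ^ 2 = sin (phi tau) ^ 2).
  { pose proof (sin2_cos2 (phi tau)) as E. unfold Rsqr in E. unfold y. simpl. lra. }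
  assert (Hy1 : y < 1).
  { assert (Hs2 : 0 < sin (phi tau) ^ 2) by (apply pow_lt; easy).
    rewrite <- Hsc in Hs2. clearbody y. nra. }
  assert (Hs : sqrt (1 - y ^ 2) = sin (phi tau)).
  { rewrite Hsc. apply sqrt_pow2. lra. }
  assert (Hu := dlog_xi_pos n xi chi (rho tau) H Hrho).
  assert (Hfy := f_sol_pow k m y Hk (conj Hy0 Hy1)). rewrite Hs in Hfy.
  rewrite Rinv_inv in *.
  rewrite Rpower_pow in HG2 by easy.
  rewrite rpow_INR in Heq by first [exact Hk|apply Rmult_le_pos; [lra|exact Hy0]]. fold y in Heq.
  rewrite Rpow_mult_distr in Heq.
  assert (HX2 : 0 < (c * chi (rho tau)) ^ k) by (apply pow_lt; easy).
  assert (Hat := attraction k m (kappa * dlog xi (rho tau) ^ (m - 1)) (c * chi (rho tau))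
                  (Gamma (rho tau)) y Hk).
  set (A := binom (n - 1) (m - 1)) in *.
  set (u := dlog xi (rho tau)) in *.
  set (X := c * chi (rho tau)) in *.
  set (g := Gamma (rho tau)) in *.
  set (f := f_sol m (/ INR k)) in *.
  set (sn := sin (phi tau)) in *.
  assert (Hum : 0 < u ^ (m - 1)) by (apply pow_lt; easy).
  assert (HS : S_cyl n m xi chi (rho tau) = X ^ k * f g) by (rewrite HG2; field; lra).
  assert (Hyk : y ^ k = f y * sn ^ m).
  { rewrite Hfy. field. apply pow_nonzero; lra. }
  rewrite HS, Hyk in Heq.
  (* The system has sin^(m-1) on the left and sin^m on the right; cancelling sin^(m-2), positive on
     Q_1, leaves sin^2 = 1 - y^2. *)
  assert (Hdy : A * u ^ (m - 1) * (- sn * Derive phi tau) = - (X ^ k * (1 - y ^ 2) * (f y - f g))).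
  { rewrite Hsc.
    assert (Hsm : 0 < sn ^ (m - 2)) by (apply pow_lt; easy).
    apply (Rmult_eq_reg_l (sn ^ (m - 2))); [|lra].
    assert (E1 : sn ^ m = sn ^ (m - 2) * sn ^ 2) by (rewrite <- pow_add; f_equal; lia).
    assert (E2 : sn ^ (m - 1) = sn ^ (m - 2) * sn ^ 1) by (rewrite <- pow_add; f_equal; lia).
    rewrite E1, E2 in Heq.
    transitivity (- (A * u ^ (m - 1) * (sn ^ (m - 2) * sn ^ 1) * Derive phi tau)); [ring|].
    rewrite Heq. ring. }
  assert (Hat' := Hat ltac:(apply Rmult_le_pos; lra) HX ltac:(lra) ltac:(lra) Hrate).
  apply (Rmult_le_reg_l (A * u ^ (m - 1))); [apply Rmult_lt_0_compat; easy|].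
  replace (A * u ^ (m - 1) * ((y - g) * (- sn * Derive phi tau)))
    with (A * u ^ (m - 1) * (- sn * Derive phi tau) * (y - g)) by ring.
  rewrite Hdy.
  replace (A * u ^ (m - 1) * (- (kappa / A) * y * (y - g) ^ 2))
    with (- (kappa * u ^ (m - 1) * y * (y - g) ^ 2)) by (field; lra).
  lra.
Qed.

(** The left-hand side of the conclusion is e^(-a rho) times the tau-derivative of e^(a rho) ((h
    w)^2 - eps^2/2), where rho' = y, [dh] and [dG] are derivatives in r, and [dy] is one in tau. *)
Lemma lyapunov_decay (a eps y h dh w dy dG : R) :
  0 < a -> 0 < eps -> 0 <= y -> 0 < h ->
  Rabs (dh / h) <= a / 4 -> Rabs dG <= a * eps / 2 * / h ->
  w * dy <= - a * y * w ^ 2 ->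
  a * y * ((h * w) ^ 2 - eps ^ 2 / 2)
  + 2 * (h * w) * (dh * y * w + h * (dy - dG * y)) <= 0.
Proof.
  intros Ha He Hy Hh Hdh HdG Hdy.
  apply Rabs_le_between in Hdh.
  set (v := h * w).
  assert (E1 : v * (dh * y * w) = y * (dh / h * v ^ 2)) by (unfold v; field; lra).
  assert (E2 : v * (h * dy) = h ^ 2 * (w * dy)) by (unfold v; ring).
  assert (E3 : h ^ 2 * (w * dy) <= - a * (y * v ^ 2)).
  { replace (- a * (y * v ^ 2)) with (h ^ 2 * (- a * y * w ^ 2)) by (unfold v; ring).
    apply Rmult_le_compat_l; [apply pow2_ge_0|easy]. }
  assert (E4 : - (v * (h * dG)) <= Rabs v * (a * eps / 2)).
  { apply Rle_trans with (Rabs (v * (h * dG))).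
    { rewrite <- Rabs_Ropp. apply Rle_abs. }
    rewrite Rabs_mult. apply Rmult_le_compat_l; [apply Rabs_pos|].
    rewrite Rabs_mult, (Rabs_right h) by lra.
    apply (Rmult_le_compat_l h) in HdG; [|lra].
    replace (h * (a * eps / 2 * / h)) with (a * eps / 2) in HdG by (field; lra). easy. }
  assert (E5 : dh / h * v ^ 2 <= a / 4 * v ^ 2) by (apply Rmult_le_compat_r; [apply pow2_ge_0|lra]).
  assert (E6 : v ^ 2 = Rabs v ^ 2) by (symmetry; apply pow2_abs).
  (* The terms add up to at most y (a v^2 - a eps^2/2 - 2 a v^2 + a v^2/2 + a eps |v|), which is
     minus this square; the constants a/4, a eps/2 and eps^2/2 are chosen for that. *)
  assert (E7 : y * (a / 2 * (Rabs v - eps) ^ 2) >= 0).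
  { apply Rle_ge, Rmult_le_pos; [easy|]. apply Rmult_le_pos; [lra|apply pow2_ge_0]. }
  assert (E8 : y * (dh / h * v ^ 2) <= y * (a / 4 * v ^ 2)) by (apply Rmult_le_compat_l; easy).
  assert (E9 : y * (- (v * (h * dG))) <= y * (Rabs v * (a * eps / 2))) by (apply Rmult_le_compat_l; easy).
  replace (2 * v * (dh * y * w + h * (dy - dG * y)))
    with (2 * (v * (dh * y * w)) + 2 * (v * (h * dy)) + 2 * (y * (- (v * (h * dG))))) by ring.
  rewrite E1, E2. rewrite E6 in *. nra.
Qed.

Lemma orbit_asymptotics (n m k : nat) (c : R) (xi chi Gamma h : R -> R)
    (I : R -> Prop) (rho phi Phi : R -> R) :
  ambient_space n xi chi -> 0 < c -> (k = m \/ k = 1%nat) ->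
  ((2 <= m <= n - 1)%nat \/
   (m = n /\ ~ X_parallel chi /\ hyperbolic_model inv_remainder xi chi)) ->
  is_Gamma n m (/ INR k) c xi chi Gamma ->
  admissible_rate n m (/ INR k) xi chi Gamma h ->
  orbit_in_Q1 n m (/ INR k) c xi chi I rho phi ->
  is_angle_function I rho phi Phi ->
  little_o_inf (fun r => cos (Phi r) - Gamma r) (fun r => / h r).
Proof.
  intros H Hc Hk Hm HG [Hh1 [Hh2 Hh3]] Horb Hang.
  assert (Hn := ambient_dim _ _ _ H).
  assert (Hmn : (2 <= m <= n)%nat) by (destruct Hm as [Hm|Hm]; lia).
  assert (Hk1 : (1 <= k)%nat) by (destruct Hk; lia).
  destruct (S_cyl_lower n m xi chi H Hm) as (beta & Hbeta & Hlow).
  assert (Hu1 := dlog_xi_pos n xi chi 1 H ltac:(lra)).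
  assert (HX1 : 0 < c * chi 1).
  { apply Rmult_lt_0_compat; [easy|apply H; lra]. }
  destruct (attraction_rate k m beta (dlog xi 1) (c * chi 1)) as (kappa & Hkap & Hrate);
    [lia|easy|easy|easy|easy|].
  assert (HA : 0 < binom (n - 1) (m - 1)) by (apply binom_pos; lia).
  set (a := kappa / binom (n - 1) (m - 1)).
  assert (Ha : 0 < a) by (apply Rdiv_lt_0_compat; easy).
  assert (Hw : forall t, 1 <= t ->
     0 < binom (n - 1) (m - 1) * dlog chi t + binom (n - 1) m * dlog xi t).
  { intros t Ht. specialize (Hlow t Ht).
    assert (Hu := dlog_xi_pos n xi chi t H ltac:(lra)). nra. }
  assert (HSge : forall t, 1 <= t -> beta * dlog xi t ^ m <= S_cyl n m xi chi t).
  { intros t Ht. apply S_cyl_ge; [easy|lia|lra|apply Hlow; easy]. }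
  assert (HSpos : forall t, 1 <= t -> 0 < S_cyl n m xi chi t).
  { intros t Ht. eapply Rlt_le_trans; [|apply HSge; easy].
    apply Rmult_lt_0_compat; [easy|apply pow_lt]. apply (dlog_xi_pos n xi chi); [easy|lra]. }
  assert (HdG : forall r, 1 < r -> 0 < Gamma r /\ is_derive Gamma r
     (- (/ INR k * (Gamma r * (1 - Gamma r ^ 2) / (1 + Gamma r ^ 2 * (INR m * / INR k - 1)) *
       Derive (fun t => ln (Rpower (chi t) (/ / INR k) / S_cyl n m xi chi t)) r)))).
  { intros r Hr. rewrite Rinv_inv.
    apply (is_derive_Gamma n m k c xi chi Gamma r); try easy.
    - intros t Ht. apply H; lra.
    - apply Derive_correct. eexists.
      apply (is_derive_log_chi_over_S n m k xi chi r H); [lia|exact Hw|easy]. }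
  apply little_o_inf_eps. intros eps Heps.
  rewrite little_o_inf_eps in Hh2.
  destruct (Hh2 (a * eps / 2)) as [M2 HM2]; [apply Rdiv_lt_0_compat; [apply Rmult_lt_0_compat; easy|lra]|].
  destruct Hh1 as [M1 HM1].
  assert (Ha4 : 0 < a / 4) by lra.
  destruct (proj2 (is_lim_spec _ _ _) Hh3 (mkposreal _ Ha4)) as [M3 HM3]. simpl in HM3.
  destruct Hang as [M4 HM4].
  set (R0 := Rmax (Rmax 1 M1) (Rmax M2 (Rmax M3 M4))).
  assert (HR0 : forall r, R0 < r -> 1 < r /\ M1 < r /\ M2 < r /\ M3 < r /\ M4 < r).
  { intros r Hr. unfold R0 in Hr. rewrite !Rmax_Rlt in Hr. tauto. }
  (* [ta], and later [t1] at radius r + 1, flank [t0, t], so that this whole interval is interior to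
     I and the differential equation holds on it. *)
  destruct (HM4 (R0 + 1)) as (ta & Ia & Ra & _); [apply HR0; lra|].
  destruct (HM4 (R0 + 2)) as (t0 & I0 & R0' & _); [apply HR0; lra|].
  assert (Hlt : forall s t, I s -> I t -> rho s < rho t -> s < t).
  { intros s t Is It Hst. destruct (Rlt_or_le s t) as [|Hle]; [easy|exfalso].
    assert (E := orbit_rho_incr _ _ _ _ _ _ _ _ _ t s Horb It Is Hle). lra. }
  (* With v = h (y - Gamma), W = e^(a rho) (v^2 - eps^2/2) decreases along the orbit;
     since rho -> +oo this forces v^2 <= eps^2 eventually. *)
  set (W := fun t => exp (a * rho t) *
                     ((h (rho t) * (cos (phi t) - Gamma (rho t))) ^ 2 - eps ^ 2 / 2)).
  assert (He2 : 0 < eps ^ 2) by (apply pow_lt; easy).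
  (* Beyond the second bound, e^(a r) >= a r gives |W(t0)| <= e^(a r) eps^2/2, so W(t) <= W(t0)
     yields v^2 - eps^2/2 <= eps^2/2. *)
  exists (Rmax (R0 + 2) (2 * Rabs (W t0) / (eps ^ 2 * a))).
  intros r Hr. apply Rmax_Rlt in Hr. destruct Hr as [Hr1 Hr2].
  destruct (HM4 r) as (t & It & Rt & ->); [apply HR0; lra|].
  destruct (HM4 (r + 1)) as (t1 & I1 & R1 & _); [apply HR0; lra|].
  assert (Hta : ta < t0) by (apply Hlt; lra || easy).
  assert (Ht0 : t0 < t) by (apply Hlt; lra || easy).
  assert (Ht1 : t < t1) by (apply Hlt; lra || easy).
  assert (Hloc : forall s, t0 <= s <= t -> locally s I).
  { intros s Hs. apply (filter_imp (fun z => ta < z /\ z < t1)).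
    - intros z Hz. apply (proj1 Horb ta t1 z Ia I1); lra.
    - apply filter_and; [apply (open_gt ta s)|apply (open_lt t1 s)]; lra. }
  assert (HW : W t <= W t0).
  { apply (nonincreasing_of_derive W (Derive W)); [lra| |]; intros s Hs.
    all: assert (Hls := Hloc s Hs); assert (Is := locally_singleton _ _ Hls).
    all: assert (Hrs : R0 < rho s) by
      (assert (E := orbit_rho_incr _ _ _ _ _ _ _ _ _ t0 s Horb I0 Is ltac:(lra)); lra).
    all: destruct (HR0 _ Hrs) as (B0 & B1 & B2 & B3 & B4).
    all: destruct (HdG _ B0) as [HGp HGd].
    all: destruct (proj2 (proj2 Horb) s Hls) as (Hrd & Hpd & _).
    all: assert (Hhd : ex_derive h (rho s)) by (apply HM1; easy).
    all: assert (Hex : ex_derive rho s) by (eexists; exact Hrd).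
    all: assert (HexG : ex_derive Gamma (rho s)) by (eexists; exact HGd).
    { apply Derive_correct. unfold W. auto_derive. repeat split; easy. }
    assert (EW : Derive W s =
      exp (a * rho s) *
      (a * cos (phi s) * ((h (rho s) * (cos (phi s) - Gamma (rho s))) ^ 2 - eps ^ 2 / 2)
       + 2 * (h (rho s) * (cos (phi s) - Gamma (rho s))) *
         (Derive h (rho s) * cos (phi s) * (cos (phi s) - Gamma (rho s))
          + h (rho s) * (- sin (phi s) * Derive phi s - Derive Gamma (rho s) * cos (phi s))))).
    { apply is_derive_unique. unfold W. auto_derive; [repeat split; easy|].
      replace (Derive (fun x => rho x) s) with (cos (phi s)) by (symmetry; apply is_derive_unique; exact Hrd).
      change (Derive (fun x => h x)) with (Derive h).
      change (Derive (fun x => phi x)) with (Derive phi).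
      change (Derive (fun x => Gamma x)) with (Derive Gamma).
      simpl. field. }
    rewrite EW.
    assert (Hh0 : 1 <= h (rho s)) by (apply HM1; easy).
    assert (Hcos : 0 <= cos (phi s)).
    { destruct (proj1 (proj2 Horb) s Is) as (_ & Hphi & _). apply cos_ge_0; lra. }
    assert (D := lyapunov_decay a eps (cos (phi s)) (h (rho s)) (Derive h (rho s))
              (cos (phi s) - Gamma (rho s)) (- sin (phi s) * Derive phi s) (Derive Gamma (rho s))).
    assert (Hdec := D Ha Heps Hcos ltac:(lra)). clear D.
    assert (Hpos := exp_pos (a * rho s)).
    assert (0 <= exp (a * rho s)) by lra.
    match type of Hdec with _ -> _ -> _ -> ?e <= 0 => assert (e <= 0) end; [|nra].
    apply Hdec; clear Hdec.
    - apply Rlt_le. specialize (HM3 _ B3). rewrite Rminus_0_r in HM3. exact HM3.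
    (* Gamma' is, up to sign, 1/k <= 1 times the expression in the condition on h. *)
    - rewrite (is_derive_unique _ _ _ HGd), Rabs_Ropp, Rabs_mult.
      specialize (HM2 _ B2). rewrite Rabs_inv, (Rabs_right (h (rho s))) in HM2 by lra.
      eapply Rle_trans; [|exact HM2].
      assert (Hk' : 1 <= INR k) by (apply (le_INR 1); easy).
      rewrite Rabs_right by (apply Rle_ge, Rlt_le, Rinv_0_lt_compat; lra).
      rewrite <- (Rmult_1_l (Rabs _)) at 2. apply Rmult_le_compat_r; [apply Rabs_pos|].
      rewrite <- Rinv_1. apply Rinv_le_contravar; lra.
    - apply (orbit_attraction n m k c kappa xi chi Gamma I rho phi s); try easy.
      intros x Hx. destruct (HG (rho s)) as [_ HG2]; [lra|].
      rewrite Rinv_inv, Rpower_pow in HG2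
        by (apply Rmult_lt_0_compat; [easy|apply H; lra]).
      assert (HXr : c * chi 1 <= c * chi (rho s)).
      { apply Rmult_le_compat_l; [lra|]. apply (ambient_SC1 _ _ _ H); lra. }
      assert (HXk : 0 < (c * chi (rho s)) ^ k) by (apply pow_lt; lra).
      apply (Hrate (dlog xi (rho s)) (c * chi (rho s)) (Gamma (rho s)) x); try lra.
      + split; [apply (dlog_xi_pos n xi chi); [easy|lra]|].
        apply (dlog_xi_le n xi chi); [easy|lra].
      + rewrite HG2. eapply Rle_trans; [apply HSge; lra|].
        right. field. lra. }
  destruct (HR0 r ltac:(lra)) as (B0 & B1 & _).
  assert (Hh0 : 1 <= h r) by (apply HM1; easy).
  assert (Hexp : 2 * Rabs (W t0) / eps ^ 2 <= exp (a * r)).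
  { pose proof (exp_ineq1_le (a * r)).
    assert (2 * Rabs (W t0) / eps ^ 2 < a * r); [|lra].
    apply (Rmult_lt_compat_l a) in Hr2; [|easy].
    replace (a * (2 * Rabs (W t0) / (eps ^ 2 * a))) with (2 * Rabs (W t0) / eps ^ 2) in Hr2
      by (field; lra). easy. }
  assert (Hexp' : Rabs (W t0) <= exp (a * r) * (eps ^ 2 / 2)).
  { apply (Rmult_le_compat_r (eps ^ 2 / 2)) in Hexp; [|lra].
    replace (2 * Rabs (W t0) / eps ^ 2 * (eps ^ 2 / 2)) with (Rabs (W t0)) in Hexp by (field; lra). easy. }
  assert (Hz : (h r * (cos (phi t) - Gamma r)) ^ 2 <= eps ^ 2).
  { assert (HWt : W t <= exp (a * r) * (eps ^ 2 / 2)) by (pose proof (Rle_abs (W t0)); lra).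
    unfold W in HWt. rewrite Rt in HWt.
    apply Rmult_le_reg_l in HWt; [lra|apply exp_pos]. }
  rewrite Rabs_inv, (Rabs_right (h r)) by lra.
  apply (Rmult_le_reg_l (h r)); [lra|].
  replace (h r * (eps * / h r)) with eps by (field; lra).
  rewrite <- (Rabs_right (h r)) at 1 by lra. rewrite <- Rabs_mult.
  rewrite <- (Rabs_right eps) by lra.
  apply Rsqr_le_abs_0. unfold Rsqr. simpl in Hz. rewrite !Rmult_1_r in Hz. exact Hz.
Qed.

(** * Reduction of the condition on h to bounds on Gamma and on logarithmic derivatives *)

(* Bounds the logarithmic derivative of chi^k / S_m in absolute value. *)
Definition rate_bound (n m k : nat) (xi chi : R -> R) (r : R) : R :=
  INR k * dlog chi r
  + (binom (n - 1) (m - 1) * Rabs (ddlog chi r) + binom (n - 1) m * Rabs (ddlog xi r))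
    / (binom (n - 1) (m - 1) * dlog chi r + binom (n - 1) m * dlog xi r)
  + INR m * (Rabs (ddlog xi r) / dlog xi r).

(** As m/k >= 1, the fraction multiplying Gamma lies in [0, 1]. The factor Gamma itself is kept,
    since its decay is essential in two of the models. *)
Lemma rate_expression_le (n m k : nat) (c : R) (xi chi Gamma : R -> R) (r : R) :
  ambient_space n xi chi -> (2 <= m)%nat -> (k = m \/ k = 1%nat) ->
  (forall t, 1 <= t ->
     0 < binom (n - 1) (m - 1) * dlog chi t + binom (n - 1) m * dlog xi t) ->
  is_Gamma n m (/ INR k) c xi chi Gamma -> 1 < r ->
  Rabs (Gamma r * (1 - Gamma r ^ 2) / (1 + Gamma r ^ 2 * (INR m * / INR k - 1)) *
        Derive (fun t => ln (Rpower (chi t) (/ / INR k) / S_cyl n m xi chi t)) r)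
  <= Gamma r * rate_bound n m k xi chi r.
Proof.
  intros H Hm Hk Hw HG Hr.
  destruct (HG r ltac:(lra)) as [Hg _].
  assert (Hk1 : 1 <= INR k) by (apply (le_INR 1); destruct Hk; lia).
  assert (Hmk : 1 <= INR m * / INR k).
  { assert (INR k <= INR m) by (apply le_INR; destruct Hk; lia).
    apply (Rmult_le_reg_r (INR k)); [lra|]. rewrite Rmult_assoc, Rinv_l; lra. }
  assert (Hm2 : 2 <= INR m) by (apply (le_INR 2); easy).
  rewrite Rinv_inv, Rabs_mult.
  apply Rmult_le_compat; try apply Rabs_pos.
  - assert (D : 1 <= 1 + Gamma r ^ 2 * (INR m * / INR k - 1)).
    { assert (0 <= Gamma r ^ 2 * (INR m * / INR k - 1)); [|lra].
      apply Rmult_le_pos; [apply pow2_ge_0|lra]. }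
    set (d := 1 + Gamma r ^ 2 * (INR m * / INR k - 1)) in *.
    assert (Hi : 0 < / d <= 1).
    { split; [apply Rinv_0_lt_compat; lra|]. rewrite <- Rinv_1. apply Rinv_le_contravar; lra. }
    assert (Hq : 0 <= 1 - Gamma r ^ 2 <= 1) by nra.
    unfold Rdiv. rewrite Rabs_right.
    + rewrite Rmult_assoc. rewrite <- (Rmult_1_r (Gamma r)) at 3.
      apply Rmult_le_compat_l; [lra|]. nra.
    + apply Rle_ge, Rmult_le_pos; [apply Rmult_le_pos|]; lra.
  - assert (HD := is_derive_unique _ _ _ (is_derive_log_chi_over_S n m k xi chi r H Hm Hw Hr)).
    eapply Rle_trans; [right; exact (f_equal Rabs HD)|]. clear HD.
    specialize (Hw r ltac:(lra)).
    assert (Hu := dlog_xi_pos n xi chi r H ltac:(lra)).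
    assert (Hv := dlog_chi_nonneg n xi chi r H ltac:(lra)).
    assert (HA := binom_nonneg (n - 1) (m - 1)). assert (HB := binom_nonneg (n - 1) m).
    unfold rate_bound, Rminus. eapply Rle_trans; [apply Rabs_triang|].
    apply Rplus_le_compat; [eapply Rle_trans; [apply Rabs_triang|]; apply Rplus_le_compat|].
    + rewrite Rabs_right; [lra|]. apply Rle_ge, Rmult_le_pos; lra.
    + rewrite Rabs_Ropp. unfold Rdiv.
      rewrite Rabs_mult, Rabs_inv, (Rabs_right (_ + _ * dlog xi r)) by lra.
      apply Rmult_le_compat_r; [apply Rlt_le, Rinv_0_lt_compat; easy|].
      eapply Rle_trans; [apply Rabs_triang|]. rewrite !Rabs_mult.
      rewrite (Rabs_right (binom (n - 1) (m - 1))), (Rabs_right (binom (n - 1) m)) by lra. lra.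
    + rewrite Rabs_Ropp, Rabs_mult. apply Rmult_le_compat; try apply Rabs_pos.
      * rewrite Rabs_right; lra.
      * unfold Rdiv. rewrite Rabs_mult, Rabs_inv, (Rabs_right (dlog xi r)) by lra. lra.
Qed.

Lemma admissible_rate_intro (n m k : nat) (c : R) (xi chi Gamma h : R -> R) :
  ambient_space n xi chi -> (2 <= m)%nat -> (k = m \/ k = 1%nat) ->
  (forall t, 1 <= t ->
     0 < binom (n - 1) (m - 1) * dlog chi t + binom (n - 1) m * dlog xi t) ->
  is_Gamma n m (/ INR k) c xi chi Gamma ->
  (forall r, 1 < r -> 1 <= h r /\ ex_derive h r) ->
  is_lim (fun r => Derive h r / h r) p_infty 0 ->
  (forall eps, 0 < eps ->
     Rbar_locally p_infty (fun r => Gamma r * rate_bound n m k xi chi r <= eps * / h r)) ->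
  admissible_rate n m (/ INR k) xi chi Gamma h.
Proof.
  intros H Hm Hk Hw HG Hh Hlim Hb.
  split; [exists 1; exact Hh|]. split; [|exact Hlim].
  apply little_o_inf_eps. intros eps He.
  destruct (Hb eps He) as [M HM]. exists (Rmax 1 M). intros r Hr. apply Rmax_Rlt in Hr.
  eapply Rle_trans; [apply (rate_expression_le n m k c); easy|].
  rewrite Rabs_inv, (Rabs_right (h r)); [apply HM; easy|].
  destruct (Hh r (proj1 Hr)). lra.
Qed.

(** Since f(x) >= x^k, the equation for Gamma gives (Gamma c chi)^k <= S_m <= T^k. *)
Lemma Gamma_le (n m k : nat) (c T : R) (xi chi Gamma : R -> R) (r : R) :
  0 < c -> (1 <= k)%nat -> is_Gamma n m (/ INR k) c xi chi Gamma -> 0 < r ->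
  0 < chi r -> 0 <= T -> S_cyl n m xi chi r <= T ^ k -> Gamma r <= T / (c * chi r).
Proof.
  intros Hc Hk HG Hr Hchi HT HS.
  destruct (HG r Hr) as [Hg HE].
  assert (HX : 0 < c * chi r) by (apply Rmult_lt_0_compat; easy).
  rewrite Rinv_inv, Rpower_pow, f_sol_pow in HE by easy.
  set (X := c * chi r) in *.
  assert (Hs : 0 < sqrt (1 - Gamma r ^ 2) <= 1).
  { split; [apply sqrt_lt_R0; nra|].
    apply Rle_trans with (sqrt 1); [apply sqrt_le_1; nra|rewrite sqrt_1; lra]. }
  assert (Hi : 1 <= / sqrt (1 - Gamma r ^ 2) ^ m).
  { rewrite <- Rinv_1 at 1. apply Rinv_le_contravar; [apply pow_lt; lra|].
    apply Rle_trans with (1 ^ m); [apply pow_incr; lra|rewrite pow1; lra]. }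
  assert (HXk : 0 < X ^ k) by (apply pow_lt; easy).
  assert (Hgk : 0 <= Gamma r ^ k) by (apply pow_le; lra).
  assert (Hle : Gamma r ^ k <= (T / X) ^ k).
  { apply Rle_trans with (Gamma r ^ k / sqrt (1 - Gamma r ^ 2) ^ m).
    { rewrite <- (Rmult_1_r (Gamma r ^ k)) at 1. apply Rmult_le_compat_l; easy. }
    rewrite HE. unfold Rdiv. rewrite Rpow_mult_distr, pow_inv.
    apply Rmult_le_compat_r; [apply Rlt_le, Rinv_0_lt_compat; easy|easy]. }
  destruct (Rle_or_lt (Gamma r) (T / X)) as [|Hlt]; [easy|exfalso].
  assert (0 <= T / X) by (apply Rmult_le_pos; [easy|apply Rlt_le, Rinv_0_lt_compat; easy]).
  assert ((T / X) ^ k < Gamma r ^ k) by (apply pow_lt_pow; lra || easy). lra.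
Qed.

(** * Growth of the functions r^p and e^(r^delta) *)

Lemma eventually_gt (M : R) : Rbar_locally p_infty (fun r => M < r).
Proof. now exists M. Qed.

Lemma Rpower_large (p C : R) : 0 < p -> Rbar_locally p_infty (fun r => C <= Rpower r p).
Proof.
  intros Hp. exists (exp (C / p)). intros r Hr.
  assert (Hln : C / p < ln r).
  { rewrite <- (ln_exp (C / p)). apply ln_increasing; [apply exp_pos|easy]. }
  apply (Rmult_lt_compat_l p) in Hln; [|easy].
  replace (p * (C / p)) with C in Hln by (field; lra).
  unfold Rpower. pose proof (exp_ineq1_le (p * ln r)). lra.
Qed.

Lemma Rpower_ge_1 (r p : R) : 1 < r -> 0 <= p -> 1 <= Rpower r p.
Proof.
  intros Hr Hp. rewrite <- (Rpower_O r) by lra. apply Rle_Rpower; lra.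
Qed.

Lemma power_rate (p : R) :
  0 < p ->
  (forall r, 1 < r -> 1 <= Rpower r p /\ ex_derive (fun t => Rpower t p) r) /\
  is_lim (fun r => Derive (fun t => Rpower t p) r / Rpower r p) p_infty 0.
Proof.
  intros Hp.
  assert (Hd : forall r, 0 < r -> is_derive (fun t => Rpower t p) r (Rpower r p * (p / r))).
  { intros r Hr. unfold Rpower. auto_derive; [easy|]. field. lra. }
  split.
  - intros r Hr. split; [apply Rpower_ge_1; lra|]. eexists. apply Hd. lra.
  - apply is_lim_spec. intros eps. pose proof (cond_pos eps) as He.
    exists (Rmax 1 (p / eps)). intros r Hr. apply Rmax_Rlt in Hr. destruct Hr as [Hr1 Hr2].
    assert (HD : Derive (fun t => Rpower t p) r = Rpower r p * (p / r)).
    { apply is_derive_unique, Hd. lra. }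
    rewrite HD.
    assert (HP : 0 < Rpower r p) by apply exp_pos.
    replace (Rpower r p * (p / r) / Rpower r p - 0) with (p / r) by (field; lra).
    rewrite Rabs_right.
    + apply (Rmult_lt_reg_r (r / eps)); [apply Rdiv_lt_0_compat; lra|].
      replace (p / r * (r / eps)) with (p / eps) by (field; lra).
      replace (eps * (r / eps)) with r by (field; lra). easy.
    + apply Rle_ge, Rlt_le, Rdiv_lt_0_compat; lra.
Qed.

(** h'/h = delta r^(delta-1), which tends to 0 because delta < 1. *)
Lemma exp_power_rate (delta : R) :
  0 < delta < 1 ->
  (forall r, 1 < r -> 1 <= exp (Rpower r delta) /\ ex_derive (fun t => exp (Rpower t delta)) r) /\
  is_lim (fun r => Derive (fun t => exp (Rpower t delta)) r / exp (Rpower r delta)) p_infty 0.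
Proof.
  intros Hdelta.
  assert (Hd : forall r, 0 < r -> is_derive (fun t => exp (Rpower t delta)) r
                 (exp (Rpower r delta) * (Rpower r delta * (delta / r)))).
  { intros r Hr. unfold Rpower. auto_derive; [easy|]. field. lra. }
  split.
  - intros r Hr. split.
    + assert (0 < Rpower r delta) by apply exp_pos. pose proof (exp_ineq1_le (Rpower r delta)). lra.
    + eexists. apply Hd. lra.
  - apply is_lim_spec. intros eps. pose proof (cond_pos eps) as He.
    destruct (Rpower_large (1 - delta) (/ eps) ltac:(lra)) as [M HM].
    exists (Rmax 1 M). intros r Hr. apply Rmax_Rlt in Hr. destruct Hr as [Hr1 Hr2].
    assert (HD : Derive (fun t => exp (Rpower t delta)) r
                 = exp (Rpower r delta) * (Rpower r delta * (delta / r))).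
    { apply is_derive_unique, Hd. lra. }
    rewrite HD.
    assert (HE : 0 < exp (Rpower r delta)) by apply exp_pos.
    assert (HP : 0 < Rpower r delta) by apply exp_pos.
    assert (HQ : 0 < Rpower r (1 - delta)) by apply exp_pos.
    assert (HPQ : r = Rpower r delta * Rpower r (1 - delta)).
    { rewrite <- Rpower_plus. replace (delta + (1 - delta)) with 1 by ring.
      rewrite Rpower_1; lra. }
    specialize (HM r Hr2).
    set (P := Rpower r delta) in *. set (Q := Rpower r (1 - delta)) in *. clearbody P Q.
    replace (exp P * (P * (delta / r)) / exp P - 0) with (delta / Q) by (rewrite HPQ; field; lra).
    rewrite Rabs_right by (apply Rle_ge, Rlt_le, Rdiv_lt_0_compat; lra).
    apply (Rmult_lt_reg_r Q); [easy|].
    unfold Rdiv. rewrite Rmult_assoc, Rinv_l, Rmult_1_r by lra.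
    apply (Rmult_le_compat_l eps) in HM; [|lra]. rewrite Rinv_r in HM; lra.
Qed.

(** For large r, r >= 2 r^delta, so r - r^delta >= r^delta, which exceeds any constant. *)
Lemma exp_neg_small (delta C eps : R) :
  0 < delta < 1 -> 0 < eps ->
  Rbar_locally p_infty (fun r => C * exp (- r) <= eps * / exp (Rpower r delta)).
Proof.
  intros Hdelta He.
  assert (L1 := Rpower_large delta (C / eps) (proj1 Hdelta)).
  assert (L2 : Rbar_locally p_infty (fun r => 2 <= Rpower r (1 - delta))) by (apply Rpower_large; lra).
  generalize (filter_and _ _ L1 (filter_and _ _ L2 (eventually_gt 1))).
  apply filter_imp. intros r (H1 & H2 & Hr).
  assert (HP : 0 < Rpower r delta) by apply exp_pos.
  assert (HPQ : r = Rpower r delta * Rpower r (1 - delta)).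
  { rewrite <- Rpower_plus. replace (delta + (1 - delta)) with 1 by ring.
    rewrite Rpower_1; lra. }
  assert (Hrr : Rpower r delta + Rpower r delta <= r).
  { apply (Rmult_le_compat_l (Rpower r delta)) in H2; lra. }
  assert (HC : C <= eps * exp (r - Rpower r delta)).
  { replace C with (eps * (C / eps)) by (field; lra). apply Rmult_le_compat_l; [lra|].
    pose proof (exp_ineq1_le (r - Rpower r delta)). lra. }
  apply (Rmult_le_compat_r (exp (- r))) in HC; [|apply Rlt_le, exp_pos].
  eapply Rle_trans; [exact HC|]. right.
  rewrite Rmult_assoc, <- exp_plus, <- exp_Ropp. do 2 f_equal. ring.
Qed.

(** * The three asymptotic models *)

Lemma remainder_derive (f g dg ddg : R -> R) (r : R) :
  extends_smoothly f ->
  (forall t, is_derive g t (dg t)) -> (forall t, is_derive dg t (ddg t)) -> 0 < r ->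
  Derive (fun t => f t - g t) r = Derive f r - dg r /\
  Derive_n (fun t => f t - g t) 2 r = Derive_n f 2 r - ddg r.
Proof.
  intros Hf Hg Hdg Hr.
  assert (D1 : forall t, 0 < t -> Derive (fun t => f t - g t) t = Derive f t - dg t).
  { intros t Ht. apply is_derive_unique.
    apply (is_derive_minus f g t (Derive f t) (dg t)); [apply (smooth_derive f t Hf Ht)|apply Hg]. }
  split; [apply D1; easy|].
  change (Derive_n (fun t => f t - g t) 2 r) with (Derive (Derive (fun t => f t - g t)) r).
  apply is_derive_unique.
  apply (is_derive_ext_loc (fun t => Derive f t - dg t)).
  { apply (filter_imp (fun t => 0 < t)); [|apply (open_gt 0 r Hr)].
    intros t Ht. symmetry. apply D1; easy. }
  apply (is_derive_minus (Derive f) dg r (Derive_n f 2 r) (ddg r)).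
  - apply (smooth_derive f r Hf Hr).
  - apply Hdg.
Qed.

Lemma rate_bound_le (n m k : nat) (xi chi : R -> R) (beta r : R) :
  ambient_space n xi chi -> 0 < beta -> 1 <= r ->
  beta * dlog xi r <= binom (n - 1) (m - 1) * dlog chi r + binom (n - 1) m * dlog xi r ->
  rate_bound n m k xi chi r
  <= INR k * dlog chi r
     + (binom (n - 1) (m - 1) * Rabs (ddlog chi r) + binom (n - 1) m * Rabs (ddlog xi r))
       / (beta * dlog xi r)
     + INR m * (Rabs (ddlog xi r) / dlog xi r).
Proof.
  intros H Hb Hr Hw. unfold rate_bound.
  assert (Hu := dlog_xi_pos n xi chi r H ltac:(lra)).
  assert (HA := binom_nonneg (n - 1) (m - 1)). assert (HB := binom_nonneg (n - 1) m).
  apply Rplus_le_compat_r, Rplus_le_compat_l. unfold Rdiv.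
  apply Rmult_le_compat_l.
  - apply Rplus_le_le_0_compat; apply Rmult_le_pos; (easy || apply Rabs_pos).
  - apply Rinv_le_contravar; [apply Rmult_lt_0_compat; easy|easy].
Qed.

Lemma ddlog_xi_abs (n : nat) (xi chi : R -> R) (r : R) :
  ambient_space n xi chi -> 0 < r -> Rabs (ddlog xi r) <= dlog xi r ^ 2.
Proof.
  intros H Hr. destruct (ddlog_xi_bounds n xi chi r H Hr). apply Rabs_le; lra.
Qed.

Lemma bracket_pos (n m : nat) (xi chi : R -> R) (beta : R) :
  ambient_space n xi chi -> 0 < beta ->
  (forall r, 1 <= r ->
    beta * dlog xi r <= binom (n - 1) (m - 1) * dlog chi r + binom (n - 1) m * dlog xi r) ->
  forall r, 1 <= r ->
    0 < binom (n - 1) (m - 1) * dlog chi r + binom (n - 1) m * dlog xi r.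
Proof.
  intros H Hb Hlow r Hr. eapply Rlt_le_trans; [|apply Hlow; easy].
  apply Rmult_lt_0_compat; [easy|]. apply (dlog_xi_pos n xi chi); [easy|lra].
Qed.

Lemma ddlog_chi_hyperbolic (n : nat) (xi chi : R -> R) (r : R) :
  ambient_space n xi chi -> hyperbolic_model inv_remainder xi chi -> 0 < r ->
  dlog chi r = / dlog xi r /\ Rabs (ddlog chi r) <= 1.
Proof.
  intros H Hh Hr.
  assert (E : forall t, 0 < t -> / dlog xi t = dlog chi t).
  { intros t Ht. assert (Hu := dlog_xi_pos n xi chi t H Ht).
    assert (Hq := hyperbolic_rigidity n xi chi t H Hh Ht).
    apply (Rmult_eq_reg_l (dlog xi t)); [rewrite Rinv_r|]; lra. }
  split; [symmetry; apply E; easy|].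
  assert (Hu := dlog_xi_pos n xi chi r H Hr).
  assert (D1 : is_derive (dlog chi) r (ddlog chi r)).
  { apply is_derive_dlog; [apply H|easy|apply H; easy]. }
  (* Differentiating chi'/chi = 1/u gives -u'/u^2, and |u'| <= u^2 makes this at most 1. *)
  assert (D2 : is_derive (dlog chi) r (- ddlog xi r / dlog xi r ^ 2)).
  { apply (is_derive_ext_loc (fun t => / dlog xi t)).
    - apply (filter_imp (fun t => 0 < t)); [exact E|apply (open_gt 0 r Hr)].
    - apply (is_derive_inv (dlog xi)); [|lra].
      apply is_derive_dlog; [apply H|easy|apply H; easy]. }
  replace (ddlog chi r) with (- ddlog xi r / dlog xi r ^ 2).
  2: { rewrite <- (is_derive_unique _ _ _ D1). symmetry. apply is_derive_unique, D2. }
  assert (Hu2 : 0 < dlog xi r ^ 2) by (apply pow_lt; easy).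
  unfold Rdiv. rewrite Rabs_mult, Rabs_Ropp, Rabs_inv, (Rabs_right (dlog xi r ^ 2)) by lra.
  apply (Rmult_le_reg_r (dlog xi r ^ 2)); [easy|].
  rewrite Rmult_assoc, Rinv_l, Rmult_1_r, Rmult_1_l by lra.
  apply (ddlog_xi_abs n xi chi); easy.
Qed.

(** For r >= 1, u stays in [1, u1] and chi'/chi in (0, 1], so S_m and [rate_bound] are bounded; then
    Gamma = O(1/chi) = O(e^(-r)). *)
Lemma admissible_hyperbolic (n m k : nat) (c delta : R) (xi chi Gamma : R -> R) :
  ambient_space n xi chi -> 0 < c -> (k = m \/ k = 1%nat) ->
  ((2 <= m <= n - 1)%nat \/
   (m = n /\ ~ X_parallel chi /\ hyperbolic_model inv_remainder xi chi)) ->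
  is_Gamma n m (/ INR k) c xi chi Gamma -> 0 < delta < 1 ->
  hyperbolic_model inv_remainder xi chi ->
  admissible_rate n m (/ INR k) xi chi Gamma (fun r => exp (Rpower r delta)).
Proof.
  intros H Hc Hk Hm HG Hdelta Hh.
  assert (Hn := ambient_dim _ _ _ H).
  assert (Hm2 : (2 <= m)%nat) by (destruct Hm as [Hm|Hm]; lia).
  assert (Hk1 : (1 <= k)%nat) by (destruct Hk; lia).
  destruct (S_cyl_lower n m xi chi H Hm) as (beta & Hbeta & Hlow).
  assert (Hb0 := proj1 Hbeta).
  assert (Hw := bracket_pos n m xi chi beta H Hb0 Hlow).
  destruct (exp_power_rate delta Hdelta) as [Hh1 Hh2].
  apply (admissible_rate_intro n m k c xi chi Gamma); try easy.
  intros eps Heps.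
  destruct Hh as [(a & Ha & Hx) (b & Hb & Hchi)].
  assert (Hh : hyperbolic_model inv_remainder xi chi).
  { split; [now exists a|now exists b]. }
  destruct (exp_equiv chi b Hb Hchi) as (M & HM & HE).
  set (A := binom (n - 1) (m - 1)) in *. set (B := binom (n - 1) m) in *.
  assert (HA : 0 <= A) by apply binom_nonneg. assert (HB : 0 <= B) by apply binom_nonneg.
  set (u1 := dlog xi 1).
  assert (Hu1 : 0 < u1) by (apply (dlog_xi_pos n xi chi); [easy|lra]).
  (* The summand 1 makes [KS] >= 1, so [KS] <= [KS]^k and [Gamma_le] applies for both values of
     k. *)
  set (KS := 1 + (A + B * u1) * u1 ^ (m - 1)).
  assert (HKS : 1 <= KS).
  { unfold KS. assert (0 <= (A + B * u1) * u1 ^ (m - 1)); [|lra].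
    apply Rmult_le_pos; [|apply pow_le; lra]. nra. }
  set (CL := INR k + (A + B * u1 ^ 2) / beta + INR m * u1).
  generalize (filter_and _ _ (eventually_gt M) (exp_neg_small delta (KS / (c * (b / 2)) * CL) eps Hdelta Heps)).
  apply filter_imp. intros r (Hr & Hsmall).
  assert (Hr0 : 0 < r) by lra.
  assert (Hu := dlog_xi_ge_1 n xi chi a r H Ha Hx Hr0).
  assert (Hule : dlog xi r <= u1) by (apply (dlog_xi_le n xi chi); [easy|lra]).
  destruct (ddlog_chi_hyperbolic n xi chi r H Hh Hr0) as [Hv Hdv].
  assert (Hdu := ddlog_xi_abs n xi chi r H Hr0).
  assert (Hv1 : 0 < dlog chi r <= 1).
  { rewrite Hv. split; [apply Rinv_0_lt_compat; lra|].
    rewrite <- Rinv_1. apply Rinv_le_contravar; lra. }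
  assert (Hchip : 0 < chi r) by (apply H; easy).
  assert (HS : S_cyl n m xi chi r <= KS ^ k).
  { apply Rle_trans with KS.
    - unfold S_cyl, KS. fold A B.
      assert ((A * dlog chi r + B * dlog xi r) * dlog xi r ^ (m - 1) <= (A + B * u1) * u1 ^ (m - 1)); [|lra].
      apply Rmult_le_compat; [nra|apply pow_le; lra|nra|apply pow_incr; lra].
    - rewrite <- (pow_1 KS) at 1. apply Rle_pow; easy. }
  assert (HGle := Gamma_le n m k c KS xi chi Gamma r Hc Hk1 HG Hr0 Hchip ltac:(lra) HS).
  destruct (HG r Hr0) as [Hg _].
  assert (Hrb : rate_bound n m k xi chi r <= CL).
  { eapply Rle_trans; [apply (rate_bound_le n m k xi chi beta); try easy; [lra|apply Hlow; lra]|].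
    fold A B. unfold CL.
    apply Rplus_le_compat; [apply Rplus_le_compat|].
    - rewrite <- (Rmult_1_r (INR k)) at 2. apply Rmult_le_compat_l; [apply pos_INR|lra].
    - unfold Rdiv.
      assert (Hdu' : Rabs (ddlog xi r) <= u1 ^ 2).
      { eapply Rle_trans; [exact Hdu|]. apply pow_incr; lra. }
      pose proof (Rabs_pos (ddlog chi r)). pose proof (Rabs_pos (ddlog xi r)).
      apply Rmult_le_compat.
      + apply Rplus_le_le_0_compat; apply Rmult_le_pos; easy.
      + apply Rlt_le, Rinv_0_lt_compat. nra.
      + apply Rplus_le_compat; [nra|]. apply Rmult_le_compat_l; easy.
      + apply Rinv_le_contravar; nra.
    - apply Rmult_le_compat_l; [apply pos_INR|].
      apply Rle_trans with (dlog xi r); [|easy].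
      apply (Rmult_le_reg_r (dlog xi r)); [lra|].
      unfold Rdiv. rewrite Rmult_assoc, Rinv_l by lra. simpl in Hdu. lra. }
  assert (HCL : 0 <= CL).
  { unfold CL. pose proof (pos_INR k). pose proof (pos_INR m).
    assert (0 <= (A + B * u1 ^ 2) / beta).
    { apply Rmult_le_pos; [|apply Rlt_le, Rinv_0_lt_compat; easy].
      assert (0 <= B * u1 ^ 2) by (apply Rmult_le_pos; [easy|apply pow2_ge_0]). lra. }
    assert (0 <= INR m * u1) by (apply Rmult_le_pos; lra). lra. }
  eapply Rle_trans; [|exact Hsmall].
  apply Rle_trans with (Gamma r * CL); [apply Rmult_le_compat_l; lra|].
  replace (KS / (c * (b / 2)) * CL * exp (- r)) with (KS / (c * (b / 2)) * exp (- r) * CL) by ring.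
  apply Rmult_le_compat_r; [easy|].
  eapply Rle_trans; [exact HGle|].
  specialize (HE r Hr). pose proof (exp_pos r) as He.
  rewrite exp_Ropp. unfold Rdiv. rewrite (Rmult_assoc KS), <- Rinv_mult.
  apply Rmult_le_compat_l; [lra|]. apply Rinv_le_contravar; [|].
  - apply Rmult_lt_0_compat; [|easy]. apply Rmult_lt_0_compat; lra.
  - rewrite Rmult_assoc. apply Rmult_le_compat_l; lra.
Qed.

(** (log f)'' vanishes for the pure exponential x = a e^r. In xi xi'' - xi'^2 the terms x^2 cancel,
    leaving O(x) over xi^2, which is of order x^2. *)
Lemma ddlog_xi_exp (n : nat) (xi chi : R -> R) (a : R) :
  ambient_space n xi chi -> 0 < a ->
  inv_remainder (fun r => xi r - a * exp r) ->
  big_O (Rbar_locally p_infty) (Derive (fun r => xi r - a * exp r)) (fun r => / r ^ 2) ->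
  big_O (Rbar_locally p_infty) (Derive_n (fun r => xi r - a * exp r) 2) (fun r => / r ^ 3) ->
  exists C M : R, 1 <= M /\ forall r, M < r -> Rabs (ddlog xi r) <= C * exp (- r).
Proof.
  intros H Ha Hx0 Hx1 Hx2.
  destruct (inv_remainder_bound _ Hx0) as (K0 & M0 & HK0 & HM0 & HE0).
  destruct (big_O_infty_bound _ _ Hx1) as (K1 & M1 & HK1 & HM1 & HE1).
  destruct (big_O_infty_bound _ _ Hx2) as (K2 & M2 & HK2 & HM2 & HE2).
  set (K := K0 + K1 + K2).
  destruct (eventually_le_exp (2 * K / a)) as (M3 & HM3 & HE3).
  (* The numerator is at most 4 K x + 2 K^2 <= 5 K x because 2 K <= x, and xi >= x/2 contributes a
     factor 4. *)
  exists (20 * K / a), (Rmax (Rmax M0 M1) (Rmax M2 M3)).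
  split; [eapply Rle_trans; [|apply Rmax_l]; eapply Rle_trans; [exact HM0|apply Rmax_l]|].
  intros r L3. rewrite !Rmax_Rlt in L3. destruct L3 as [[B0 B1] [B2 B3]].
  assert (Hr0 : 0 < r) by lra.
  destruct (remainder_derive xi (fun t => a * exp t) (fun t => a * exp t) (fun t => a * exp t) r)
    as [R1 R2]; [apply H| | |easy|].
  { intros t. auto_derive; [easy|ring]. }
  { intros t. auto_derive; [easy|ring]. }
  specialize (HE0 r B0). specialize (HE1 r B1). specialize (HE2 r B2). specialize (HE3 r B3).
  rewrite R1 in HE1. rewrite R2 in HE2.
  assert (Hir : 0 < / r <= 1).
  { split; [apply Rinv_0_lt_compat; easy|]. rewrite <- Rinv_1. apply Rinv_le_contravar; lra. }
  assert (Hi2 : 0 < / r ^ 2 <= 1).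
  { rewrite <- pow_inv. split; [apply pow_lt; lra|]. rewrite <- (pow1 2). apply pow_incr; lra. }
  assert (Hi3 : 0 < / r ^ 3 <= 1).
  { rewrite <- pow_inv. split; [apply pow_lt; lra|]. rewrite <- (pow1 3). apply pow_incr; lra. }
  rewrite (Rabs_right (/ r ^ 2)) in HE1 by lra. rewrite (Rabs_right (/ r ^ 3)) in HE2 by lra.
  assert (HKx : 2 * K <= a * exp r).
  { apply (Rmult_le_compat_l a) in HE3; [|lra].
    replace (a * (2 * K / a)) with (2 * K) in HE3 by (field; lra). easy. }
  set (x := a * exp r) in *.
  set (E0 := xi r - x) in *. set (E1 := Derive xi r - x) in *.
  set (E2 := Derive_n xi 2 r - x) in *.
  assert (F0 : Rabs E0 <= K) by (unfold Rdiv in HE0; unfold K; nra).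
  assert (F1 : Rabs E1 <= K) by (unfold K; nra).
  assert (F2 : Rabs E2 <= K) by (unfold K; nra).
  assert (HK : 0 < K) by (unfold K; lra).
  assert (Hxi : x / 2 <= xi r).
  { apply Rabs_le_between in F0. unfold E0 in F0. lra. }
  assert (Eq : ddlog xi r = (x * (E2 + E0 - 2 * E1) + E2 * E0 - E1 ^ 2) / xi r ^ 2).
  { unfold ddlog, dlog, E0, E1, E2. field. lra. }
  assert (Hnum : Rabs (x * (E2 + E0 - 2 * E1) + E2 * E0 - E1 ^ 2) <= 5 * K * x).
  { apply Rabs_le_between in F0. apply Rabs_le_between in F1. apply Rabs_le_between in F2.
    assert (Q1 : Rabs (E2 + E0 - 2 * E1) <= 4 * K) by (apply Rabs_le; lra).
    assert (Q2 : Rabs (E2 * E0) <= K * K).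
    { rewrite Rabs_mult. apply Rmult_le_compat; try apply Rabs_pos; apply Rabs_le; lra. }
    assert (Q3 : Rabs (E1 ^ 2) <= K * K).
    { simpl. rewrite Rmult_1_r, Rabs_mult.
      apply Rmult_le_compat; try apply Rabs_pos; apply Rabs_le; lra. }
    unfold Rminus. eapply Rle_trans; [apply Rabs_triang|].
    rewrite Rabs_Ropp. eapply Rle_trans; [apply Rplus_le_compat_r, Rabs_triang|].
    rewrite Rabs_mult, (Rabs_right x) by lra.
    assert (x * Rabs (E2 + E0 - 2 * E1) <= x * (4 * K)) by (apply Rmult_le_compat_l; lra).
    unfold Rminus in *. nra. }
  rewrite Eq. unfold Rdiv. rewrite Rabs_mult, Rabs_inv.
  assert (Hxi2 : (x / 2) ^ 2 <= xi r ^ 2) by (apply pow_incr; lra).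
  assert (Hx22 : 0 < (x / 2) ^ 2) by (apply pow_lt; lra).
  rewrite (Rabs_right (xi r ^ 2)) by lra.
  apply Rle_trans with (5 * K * x * / (x / 2) ^ 2).
  - apply Rmult_le_compat; [apply Rabs_pos| |easy|].
    + apply Rlt_le, Rinv_0_lt_compat; lra.
    + apply Rinv_le_contravar; easy.
  - right. rewrite exp_Ropp. unfold x. pose proof (exp_pos r). field. split; lra.
Qed.

(** Gamma is estimated by 1. The decay comes from [ddlog_xi_exp] for the terms in u', and from the
    two hypotheses on chi' and chi'' for the others, chi being bounded below by chi(1). *)
Lemma admissible_product (n m k : nat) (c delta : R) (xi chi Gamma : R -> R) :
  ambient_space n xi chi -> 0 < c -> (k = m \/ k = 1%nat) ->
  ((2 <= m <= n - 1)%nat \/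
   (m = n /\ ~ X_parallel chi /\ hyperbolic_model inv_remainder xi chi)) ->
  is_Gamma n m (/ INR k) c xi chi Gamma -> 0 < delta < 1 ->
  product_model inv_remainder2 xi chi ->
  little_o_inf (Derive chi) (fun r => / exp (Rpower r delta)) ->
  little_o_inf (Derive_n chi 2) (fun r => / exp (Rpower r delta)) ->
  admissible_rate n m (/ INR k) xi chi Gamma (fun r => exp (Rpower r delta)).
Proof.
  intros H Hc Hk Hm HG Hdelta [(a & Ha & Hx0 & Hx1 & Hx2) _] Ho1 Ho2.
  assert (Hn := ambient_dim _ _ _ H).
  assert (Hm2 : (2 <= m)%nat) by (destruct Hm as [Hm|Hm]; lia).
  destruct (S_cyl_lower n m xi chi H Hm) as (beta & Hbeta & Hlow).
  assert (Hb0 := proj1 Hbeta).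
  assert (Hw := bracket_pos n m xi chi beta H Hb0 Hlow).
  destruct (exp_power_rate delta Hdelta) as [Hh1 Hh2].
  apply (admissible_rate_intro n m k c xi chi Gamma); try easy.
  intros eps Heps.
  set (A := binom (n - 1) (m - 1)) in *. set (B := binom (n - 1) m) in *.
  assert (HA : 0 <= A) by apply binom_nonneg. assert (HB : 0 <= B) by apply binom_nonneg.
  set (x1 := chi 1).
  assert (Hx1p : 0 < x1) by (apply H; lra).
  set (C1 := / x1). set (C2 := / x1 + / x1 ^ 2).
  assert (HC1 : 0 < C1) by (apply Rinv_0_lt_compat; easy).
  assert (HC2 : 0 < C2).
  { unfold C2. apply Rplus_lt_0_compat; [easy|]. apply Rinv_0_lt_compat, pow_lt; easy. }
  (* Collects the coefficients of the three terms of [rate_bound], each of whose ingredients will be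
     at most a constant times (eps / D) / h. *)
  set (D := 1 + INR k * C1 + (A * C2 + B) / beta + INR m).
  assert (HD : 1 <= D).
  { unfold D. pose proof (pos_INR m).
    assert (0 <= INR k * C1) by (apply Rmult_le_pos; [apply pos_INR|lra]).
    assert (0 <= (A * C2 + B) / beta); [|lra].
    apply Rmult_le_pos; [nra|apply Rlt_le, Rinv_0_lt_compat; easy]. }
  set (e := eps / D).
  assert (He : 0 < e) by (apply Rdiv_lt_0_compat; lra).
  (* The cap at 1 lets the square (chi'/chi)^2 inside [ddlog chi] be bounded by a first-order
     term. *)
  set (e1 := Rmin 1 e).
  assert (He1 : 0 < e1 <= 1) by (unfold e1; split; [apply Rmin_glb_lt; lra|apply Rmin_l]).
  assert (He1e : e1 <= e) by apply Rmin_r.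
  rewrite little_o_inf_eps in Ho1, Ho2.
  assert (L1 := Ho1 e1 (proj1 He1)). assert (L2 := Ho2 e1 (proj1 He1)).
  destruct (ddlog_xi_exp n xi chi a H Ha Hx0 Hx1 Hx2) as (C3 & M3 & HM3 & HE3).
  assert (L3 := eventually_gt M3).
  assert (L4 := exp_neg_small delta C3 e Hdelta He).
  generalize (filter_and (F := Rbar_locally p_infty) _ _ L1
               (filter_and (F := Rbar_locally p_infty) _ _ L2 (filter_and _ _ L3 L4))).
  apply filter_imp. clear L1 L2 L3 L4. intros r (L1 & L2 & L3 & L4).
  assert (Hr0 : 0 < r) by lra.
  assert (Hexp : 0 < exp (Rpower r delta)) by apply exp_pos.
  assert (Hh : 1 <= exp (Rpower r delta)) by (apply Hh1; lra).
  set (ih := / exp (Rpower r delta)) in *.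
  assert (Hih : 0 < ih <= 1).
  { split; [apply Rinv_0_lt_compat; easy|]. unfold ih. rewrite <- Rinv_1.
    apply Rinv_le_contravar; lra. }
  rewrite (Rabs_right ih) in L1, L2 by lra.
  assert (Hchi : x1 <= chi r) by (apply (ambient_SC1 _ _ _ H); lra).
  assert (Hu := dlog_xi_ge_1 n xi chi a r H Ha Hx0 Hr0).
  assert (Hichi : 0 < / chi r <= / x1).
  { split; [apply Rinv_0_lt_compat; lra|apply Rinv_le_contravar; lra]. }
  assert (He1ih : 0 < e1 * ih <= 1).
  { split; [apply Rmult_lt_0_compat; lra|]. nra. }
  assert (Hv0 : 0 <= dlog chi r) by (apply (dlog_chi_nonneg n xi chi); easy).
  assert (Hv : dlog chi r <= C1 * (e * ih)).
  { apply Rle_trans with (Rabs (Derive chi r) * / chi r).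
    - unfold dlog, Rdiv. apply Rmult_le_compat_r; [lra|apply Rle_abs].
    - rewrite (Rmult_comm C1). apply Rmult_le_compat; [apply Rabs_pos|lra| |unfold C1; lra].
      eapply Rle_trans; [exact L1|]. apply Rmult_le_compat_r; lra. }
  assert (Hdv : Rabs (ddlog chi r) <= C2 * (e * ih)).
  { unfold ddlog, Rminus. eapply Rle_trans; [apply Rabs_triang|].
    unfold C2. rewrite Rmult_plus_distr_r. apply Rplus_le_compat.
    - unfold Rdiv. rewrite Rabs_mult, Rabs_inv, (Rabs_right (chi r)) by lra.
      rewrite (Rmult_comm (/ x1)). apply Rmult_le_compat; [apply Rabs_pos|lra| |lra].
      eapply Rle_trans; [exact L2|]. apply Rmult_le_compat_r; lra.
    - rewrite Rabs_Ropp, Rabs_right by (apply Rle_ge, pow2_ge_0).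
      apply Rle_trans with ((e1 * ih * / x1) ^ 2).
      { apply pow_incr. split; [easy|].
        apply Rle_trans with (Rabs (Derive chi r) * / chi r).
        - unfold dlog, Rdiv. apply Rmult_le_compat_r; [lra|apply Rle_abs].
        - apply Rmult_le_compat; [apply Rabs_pos|lra|easy|lra]. }
      rewrite Rpow_mult_distr, pow_inv. rewrite Rmult_comm.
      apply Rmult_le_compat_l; [apply Rlt_le, Rinv_0_lt_compat, pow_lt; easy|].
      apply Rle_trans with (e1 * ih); [simpl; nra|]. apply Rmult_le_compat_r; lra. }
  assert (Hdu : Rabs (ddlog xi r) <= e * ih).
  { eapply Rle_trans; [|exact L4]. apply HE3. easy. }
  destruct (HG r Hr0) as [Hg _].
  assert (Heih : 0 < e * ih) by (apply Rmult_lt_0_compat; lra).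
  assert (Hrb : rate_bound n m k xi chi r <= eps * ih).
  { eapply Rle_trans; [apply (rate_bound_le n m k xi chi beta); try easy; [lra|apply Hlow; lra]|].
    fold A B.
    assert (T1 : INR k * dlog chi r <= INR k * C1 * (e * ih)).
    { rewrite Rmult_assoc. apply Rmult_le_compat_l; [apply pos_INR|easy]. }
    pose proof (Rabs_pos (ddlog chi r)). pose proof (Rabs_pos (ddlog xi r)).
    assert (T2 : (A * Rabs (ddlog chi r) + B * Rabs (ddlog xi r)) / (beta * dlog xi r)
                 <= (A * C2 + B) / beta * (e * ih)).
    { replace ((A * C2 + B) / beta * (e * ih)) with ((A * (C2 * (e * ih)) + B * (e * ih)) * / beta)
        by (field; lra).
      unfold Rdiv. apply Rmult_le_compat.
      - apply Rplus_le_le_0_compat; apply Rmult_le_pos; easy.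
      - apply Rlt_le, Rinv_0_lt_compat, Rmult_lt_0_compat; lra.
      - apply Rplus_le_compat; apply Rmult_le_compat_l; easy.
      - apply Rinv_le_contravar; [easy|]. rewrite <- (Rmult_1_r beta) at 1.
        apply Rmult_le_compat_l; lra. }
    assert (T3 : INR m * (Rabs (ddlog xi r) / dlog xi r) <= INR m * (e * ih)).
    { apply Rmult_le_compat_l; [apply pos_INR|].
      apply Rle_trans with (Rabs (ddlog xi r)); [|easy].
      apply (Rmult_le_reg_r (dlog xi r)); [lra|].
      unfold Rdiv. rewrite Rmult_assoc, Rinv_l by lra. nra. }
    replace (eps * ih) with (D * (e * ih)) by (unfold e; field; lra).
    unfold D. lra. }
  apply Rle_trans with (1 * rate_bound n m k xi chi r); [|lra].
  apply Rmult_le_compat_r; [|lra].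
  unfold rate_bound. fold A B.
  pose proof (Rabs_pos (ddlog chi r)). pose proof (Rabs_pos (ddlog xi r)).
  apply Rplus_le_le_0_compat; [apply Rplus_le_le_0_compat|].
  - apply Rmult_le_pos; [apply pos_INR|easy].
  - apply Rmult_le_pos.
    + apply Rplus_le_le_0_compat; apply Rmult_le_pos; easy.
    + apply Rlt_le, Rinv_0_lt_compat, Hw. lra.
  - apply Rmult_le_pos; [apply pos_INR|]. apply Rmult_le_pos; [easy|].
    apply Rlt_le, Rinv_0_lt_compat. lra.
Qed.

(** u is of order 1/r and chi'/chi = O(r^(-2)), so S_m = O(r^(-m)), Gamma = O(r^(-m alpha)) and
    [rate_bound] = O(1/r). Against h there remains the exponent 1 - delta alpha > 0. *)
Lemma admissible_Euclidean (n m k : nat) (c delta : R) (xi chi Gamma : R -> R) :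
  ambient_space n xi chi -> 0 < c -> (k = m \/ k = 1%nat) ->
  ((2 <= m <= n - 1)%nat \/
   (m = n /\ ~ X_parallel chi /\ hyperbolic_model inv_remainder xi chi)) ->
  is_Gamma n m (/ INR k) c xi chi Gamma -> 0 < delta < 1 ->
  Euclidean_model inv_remainder2 xi chi ->
  admissible_rate n m (/ INR k) xi chi Gamma
    (fun r => Rpower r ((INR m + delta) * / INR k)).
Proof.
  intros H Hc Hk Hm HG Hdelta [(Hx0 & Hx1 & _) (ci & _ & _ & Hc1 & Hc2)].
  assert (Hn := ambient_dim _ _ _ H).
  assert (Hm2 : (2 <= m)%nat) by (destruct Hm as [Hm|Hm]; lia).
  assert (Hk1 : (1 <= k)%nat) by (destruct Hk; lia).
  assert (Hk1' : 1 <= INR k) by (apply (le_INR 1); easy).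
  assert (Hal : 0 < / INR k <= 1).
  { split; [apply Rinv_0_lt_compat; lra|]. rewrite <- Rinv_1. apply Rinv_le_contravar; lra. }
  assert (Hm0 := pos_INR m).
  destruct (S_cyl_lower n m xi chi H Hm) as (beta & Hbeta & Hlow).
  assert (Hb0 := proj1 Hbeta).
  assert (Hw := bracket_pos n m xi chi beta H Hb0 Hlow).
  destruct (power_rate ((INR m + delta) * / INR k)) as [Hh1 Hh2].
  { apply Rmult_lt_0_compat; lra. }
  apply (admissible_rate_intro n m k c xi chi Gamma); try easy.
  intros eps Heps.
  set (A := binom (n - 1) (m - 1)) in *. set (B := binom (n - 1) m) in *.
  assert (HA : 0 <= A) by apply binom_nonneg. assert (HB : 0 <= B) by apply binom_nonneg.
  set (x1 := chi 1).
  assert (Hx1p : 0 < x1) by (apply H; lra).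
  destruct (inv_remainder_bound _ Hx0) as (K0 & M0 & HK0 & HM0 & HE0).
  destruct (big_O_infty_bound _ _ Hx1) as (K1 & M1 & HK1 & HM1 & HE1).
  destruct (big_O_infty_bound _ _ Hc1) as (K3 & M3 & HK3 & HM3 & HE3).
  destruct (big_O_infty_bound _ _ Hc2) as (K4 & M4 & HK4 & HM4 & HE4).
  set (C1 := K3 / x1). set (C2 := K4 / x1 + C1 ^ 2).
  assert (HC1 : 0 < C1) by (apply Rdiv_lt_0_compat; easy).
  assert (HC1' : 0 < C1 ^ 2) by (apply pow_lt; easy).
  assert (HC2 : 0 < C2).
  { unfold C2. apply Rplus_lt_0_compat; [apply Rdiv_lt_0_compat; easy|easy]. }
  set (CL := INR k * C1 + (A * C2 + B * 4) / beta + INR m * 2).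
  assert (HCL : 0 <= CL).
  { unfold CL. assert (0 <= INR k * C1) by (apply Rmult_le_pos; lra).
    assert (0 <= (A * C2 + B * 4) / beta); [|lra].
    apply Rmult_le_pos; [nra|apply Rlt_le, Rinv_0_lt_compat; easy]. }
  set (KS := 1 + (A * C1 + B * 2) * 2 ^ (m - 1)).
  assert (HKS : 1 <= KS).
  { unfold KS. assert (0 <= (A * C1 + B * 2) * 2 ^ (m - 1)); [|lra].
    apply Rmult_le_pos; [nra|apply pow_le; lra]. }
  set (Cf := KS / (c * x1) * CL).
  assert (L1 : Rbar_locally p_infty (fun r => Cf / eps <= Rpower r (1 - delta * / INR k))).
  { apply Rpower_large. nra. }
  assert (L2 : Rbar_locally p_infty
     (fun r => Rmax (Rmax M0 M1) (Rmax (Rmax M3 M4) (2 * K0 + K1)) < r)) by apply eventually_gt.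
  generalize (filter_and _ _ L1 L2). clear L1 L2.
  apply filter_imp. intros r (L1 & L2).
  rewrite !Rmax_Rlt in L2. destruct L2 as [[B0 B1] [[B3 B4] B5]].
  assert (Hr0 : 0 < r) by lra.
  assert (Hir : 0 < / r <= 1).
  { split; [apply Rinv_0_lt_compat; easy|]. rewrite <- Rinv_1. apply Rinv_le_contravar; lra. }
  assert (Hi2 : / r ^ 2 = / r * / r) by (field; lra).
  assert (Hi3 : / r ^ 3 = / r * / r * / r) by (field; lra).
  assert (Hi2' : 0 < / r * / r <= / r).
  { split; [apply Rmult_lt_0_compat; lra|].
    rewrite <- (Rmult_1_r (/ r)) at 3. apply Rmult_le_compat_l; lra. }
  assert (Hi3' : 0 < / r * / r * / r <= / r * / r).
  { split; [apply Rmult_lt_0_compat; lra|].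
    rewrite <- (Rmult_1_r (/ r * / r)) at 2. apply Rmult_le_compat_l; lra. }
  destruct (remainder_derive xi (fun t => t) (fun _ => 1) (fun _ => 0) r) as [R1 _];
    [apply H|intros t; auto_derive; easy|intros t; auto_derive; easy|easy|].
  destruct (remainder_derive chi (fun t => ci) (fun _ => 0) (fun _ => 0) r) as [R3 R4];
    [apply H|intros t; auto_derive; easy|intros t; auto_derive; easy|easy|].
  specialize (HE0 r B0). specialize (HE1 r B1). specialize (HE3 r B3). specialize (HE4 r B4).
  rewrite R1 in HE1. rewrite R3, Rminus_0_r in HE3. rewrite R4, Rminus_0_r in HE4.
  rewrite Hi2, (Rabs_right (/ r * / r)) in HE1, HE3 by lra.
  rewrite Hi3, (Rabs_right (/ r * / r * / r)) in HE4 by lra.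
  assert (Hchi : x1 <= chi r) by (apply (ambient_SC1 _ _ _ H); lra).
  assert (Hichi : 0 < / chi r <= / x1).
  { split; [apply Rinv_0_lt_compat; lra|apply Rinv_le_contravar; lra]. }
  assert (Hxip : 0 < xi r) by (apply H; easy).
  assert (Hu0 : / r <= dlog xi r) by (apply (dlog_xi_ge n xi chi); easy).
  (* Amounts to r + K1/r <= 2 (r - K0/r), which r > 2 K0 + K1 guarantees. *)
  assert (Hu : dlog xi r <= 2 * / r).
  { apply Rabs_le_between in HE0. apply Rabs_le_between in HE1.
    assert (F0 : r - K0 * / r <= xi r) by (unfold Rdiv in HE0; lra).
    assert (F1 : Derive xi r <= 1 + K1 * (/ r * / r)) by lra.
    apply (Rmult_le_reg_r (xi r * r)); [apply Rmult_lt_0_compat; easy|].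
    replace (dlog xi r * (xi r * r)) with (Derive xi r * r) by (unfold dlog; field; lra).
    replace (2 * / r * (xi r * r)) with (2 * xi r) by (field; lra).
    apply Rle_trans with ((1 + K1 * (/ r * / r)) * r); [apply Rmult_le_compat_r; lra|].
    replace ((1 + K1 * (/ r * / r)) * r) with (r + K1 * / r) by (field; lra).
    nra. }
  assert (Hv0 : 0 <= dlog chi r) by (apply (dlog_chi_nonneg n xi chi); easy).
  assert (Hv : dlog chi r <= C1 * (/ r * / r)).
  { apply Rle_trans with (Rabs (Derive chi r) * / chi r).
    - unfold dlog, Rdiv. apply Rmult_le_compat_r; [lra|apply Rle_abs].
    - replace (C1 * (/ r * / r)) with (K3 * (/ r * / r) * / x1) by (unfold C1; field; lra).
      apply Rmult_le_compat; [apply Rabs_pos|lra|easy|lra]. }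
  assert (Hv' : dlog chi r <= C1 * / r).
  { eapply Rle_trans; [exact Hv|]. apply Rmult_le_compat_l; lra. }
  assert (Hdv : Rabs (ddlog chi r) <= C2 * (/ r * / r)).
  { unfold ddlog, Rminus. eapply Rle_trans; [apply Rabs_triang|].
    unfold C2. rewrite Rmult_plus_distr_r. apply Rplus_le_compat.
    - unfold Rdiv. rewrite Rabs_mult, Rabs_inv, (Rabs_right (chi r)) by lra.
      replace (K4 * / x1 * (/ r * / r)) with (K4 * (/ r * / r) * / x1) by ring.
      apply Rmult_le_compat; [apply Rabs_pos|lra| |lra].
      eapply Rle_trans; [exact HE4|]. apply Rmult_le_compat_l; lra.
    - rewrite Rabs_Ropp, Rabs_right by (apply Rle_ge, pow2_ge_0).
      replace (C1 ^ 2 * (/ r * / r)) with ((C1 * / r) ^ 2) by (simpl; ring).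
      apply pow_incr. lra. }
  assert (Hdu : Rabs (ddlog xi r) <= dlog xi r ^ 2) by (apply (ddlog_xi_abs n xi chi); easy).
  assert (Hu2 : dlog xi r ^ 2 <= 4 * (/ r * / r)).
  { replace (4 * (/ r * / r)) with ((2 * / r) ^ 2) by (simpl; ring). apply pow_incr; lra. }
  assert (Hrb : rate_bound n m k xi chi r <= CL * / r).
  { eapply Rle_trans; [apply (rate_bound_le n m k xi chi beta); try easy; [lra|apply Hlow; lra]|].
    fold A B. pose proof (Rabs_pos (ddlog chi r)). pose proof (Rabs_pos (ddlog xi r)).
    assert (T1 : INR k * dlog chi r <= INR k * (C1 * / r)) by (apply Rmult_le_compat_l; lra).
    assert (T2 : (A * Rabs (ddlog chi r) + B * Rabs (ddlog xi r)) / (beta * dlog xi r)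
                 <= (A * C2 + B * 4) / beta * / r).
    { replace ((A * C2 + B * 4) / beta * / r)
        with ((A * (C2 * (/ r * / r)) + B * (4 * (/ r * / r))) * / (beta * / r)) by (field; lra).
      unfold Rdiv. apply Rmult_le_compat.
      - apply Rplus_le_le_0_compat; apply Rmult_le_pos; easy.
      - apply Rlt_le, Rinv_0_lt_compat. apply Rmult_lt_0_compat; lra.
      - apply Rplus_le_compat; apply Rmult_le_compat_l; lra.
      - apply Rinv_le_contravar; [apply Rmult_lt_0_compat; lra|]. apply Rmult_le_compat_l; lra. }
    assert (T3 : INR m * (Rabs (ddlog xi r) / dlog xi r) <= INR m * (2 * / r)).
    { apply Rmult_le_compat_l; [easy|].
      apply Rle_trans with (dlog xi r); [|easy].
      apply (Rmult_le_reg_r (dlog xi r)); [lra|].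
      unfold Rdiv. rewrite Rmult_assoc, Rinv_l by lra. simpl in Hdu. lra. }
    unfold CL. lra. }
  (* A k-th root of [KS]^k r^(-m); again [KS] >= 1 allows [KS] <= [KS]^k. *)
  set (T := KS * Rpower r (- (INR m * / INR k))).
  assert (HTk : T ^ k = KS ^ k * / r ^ m).
  { unfold T. rewrite Rpow_mult_distr. f_equal.
    rewrite <- Rpower_pow by apply exp_pos. rewrite Rpower_mult.
    replace (- (INR m * / INR k) * INR k) with (- INR m) by (field; lra).
    rewrite Rpower_Ropp, Rpower_pow by easy. easy. }
  assert (HT : 0 <= T) by (apply Rmult_le_pos; [lra|apply Rlt_le, exp_pos]).
  assert (HS : S_cyl n m xi chi r <= T ^ k).
  { rewrite HTk. apply Rle_trans with (KS * / r ^ m).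
    2: { apply Rmult_le_compat_r; [apply Rlt_le, Rinv_0_lt_compat, pow_lt; easy|].
         rewrite <- (pow_1 KS) at 1. apply Rle_pow; easy. }
    apply Rle_trans with ((A * C1 + B * 2) * 2 ^ (m - 1) * / r ^ m).
    2: { apply Rmult_le_compat_r; [apply Rlt_le, Rinv_0_lt_compat, pow_lt; easy|unfold KS; lra]. }
    replace ((A * C1 + B * 2) * 2 ^ (m - 1) * / r ^ m)
      with ((A * (C1 * / r) + B * (2 * / r)) * (2 * / r) ^ (m - 1)).
    2: { rewrite Rpow_mult_distr, pow_inv.
         replace (r ^ m) with (r * r ^ (m - 1)).
         - field. split; [apply pow_nonzero; lra|lra].
         - change (r * r ^ (m - 1)) with (r ^ S (m - 1)). f_equal. lia. }
    unfold S_cyl. fold A B. apply Rmult_le_compat.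
    - apply Rplus_le_le_0_compat; apply Rmult_le_pos; lra.
    - apply pow_le; lra.
    - apply Rplus_le_compat; apply Rmult_le_compat_l; lra.
    - apply pow_incr; lra. }
  assert (Hchip : 0 < chi r) by lra.
  assert (HGle := Gamma_le n m k c T xi chi Gamma r Hc Hk1 HG Hr0 Hchip HT HS).
  destruct (HG r Hr0) as [Hg _].
  assert (HGle' : Gamma r <= T / (c * x1)).
  { eapply Rle_trans; [exact HGle|]. apply Rmult_le_compat_l; [easy|].
    apply Rinv_le_contravar; [apply Rmult_lt_0_compat; easy|]. apply Rmult_le_compat_l; lra. }
  apply Rle_trans with (T / (c * x1) * (CL * / r)).
  { apply Rle_trans with (Gamma r * (CL * / r)); [apply Rmult_le_compat_l; lra|].
    apply Rmult_le_compat_r; [apply Rmult_le_pos; lra|easy]. }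
  rewrite <- Rpower_Ropp.
  replace (T / (c * x1) * (CL * / r)) with (Cf * (Rpower r (- (INR m * / INR k)) * / r))
    by (unfold T, Cf; field; lra).
  replace (/ r) with (Rpower r (- (1))) by (rewrite Rpower_Ropp, Rpower_1 by easy; easy).
  rewrite <- Rpower_plus.
  replace (- ((INR m + delta) * / INR k))
    with (1 - delta * / INR k + (- (INR m * / INR k) + - (1))) by ring.
  rewrite (Rpower_plus (1 - delta * / INR k)), <- Rmult_assoc.
  apply Rmult_le_compat_r; [apply Rlt_le, exp_pos|].
  apply (Rmult_le_compat_l eps) in L1; [|lra].
  replace (eps * (Cf / eps)) with Cf in L1 by (field; lra). easy.
Qed.

Theorem proposition16 :
  forall (n m : nat) (alpha c : R) (xi chi Gamma : R -> R),
    ambient_space n xi chi ->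
    0 < c ->
    (alpha = / INR m \/ alpha = 1) ->
    ((2 <= m <= n - 1)%nat \/
     (m = n /\ ~ X_parallel chi /\ hyperbolic_model inv_remainder xi chi)) ->
    is_Gamma n m alpha c xi chi Gamma ->
    (forall h : R -> R,
       admissible_rate n m alpha xi chi Gamma h ->
       forall (I : R -> Prop) (rho phi Phi : R -> R),
         orbit_in_Q1 n m alpha c xi chi I rho phi ->
         is_angle_function I rho phi Phi ->
         little_o_inf (fun r => cos (Phi r) - Gamma r) (fun r => / h r)) /\
    (forall delta : R, 0 < delta < 1 ->
       (Euclidean_model inv_remainder2 xi chi ->
        admissible_rate n m alpha xi chi Gamma
          (fun r => Rpower r ((INR m + delta) * alpha))) /\
       (product_model inv_remainder2 xi chi ->
        little_o_inf (Derive chi) (fun r => / exp (Rpower r delta)) ->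
        little_o_inf (Derive_n chi 2) (fun r => / exp (Rpower r delta)) ->
        admissible_rate n m alpha xi chi Gamma
          (fun r => exp (Rpower r delta))) /\
       (hyperbolic_model inv_remainder xi chi ->
        admissible_rate n m alpha xi chi Gamma
          (fun r => exp (Rpower r delta)))).
Proof.
  intros n m alpha c xi chi Gamma H Hc Halpha Hm HG.
  (* Both values of alpha are reciprocals of a natural number k, which turns the real powers of
     exponent 1/alpha into integer ones. *)
  assert (Hk : exists k : nat, (k = m \/ k = 1%nat) /\ alpha = / INR k).
  { destruct Halpha as [->| ->]; [now exists m; auto|].
    exists 1%nat. split; [auto|]. simpl. field. }
  destruct Hk as (k & Hk & ->).
  split.
  - intros h Hh I rho phi Phi Horb Hang.
    apply (orbit_asymptotics n m k c xi chi Gamma h I rho phi); easy.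
  - intros delta Hdelta. split; [|split].
    + apply (admissible_Euclidean n m k c); easy.
    + apply (admissible_product n m k c); easy.
    + apply (admissible_hyperbolic n m k c); easy.
Qed.
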